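(* Let $G\subset U(V)$ be a finite complex reflection group. The set $K^{sing}$ of singular parameter values consists of an infinite union of hyperplanes $K_{m,\tau}$. Here $K_{m,\tau}$ denotes the hyperplane in the space of complex parameters $k=(k_{C,i})$ given by the equation $m+c_\tau(k)=0$, and the union runs only over pairs $(m,\tau)$ with $m\in\mathbb{N}$, $\tau\in\hat G$ nontrivial and $P_{m,\tau}\neq0$.
   Context: $V$ is a finite dimensional complex Hilbert space. A complex reflection is an element $g\in U(V)$ of finite order such that $\operatorname{Ker}(g-\operatorname{Id})$ is a hyperplane; a finite complex reflection group is a finite subgroup $G\subset U(V)$ generated by complex reflections. For a hyperplane $H$, $G_H\subset G$ is the (cyclic) pointwise stabilizer; $H$ is a reflection hyperplane if $G_H\ne\{\operatorname{Id}\}$, and then $e_H=|G_H|$. $\mathcal{A}$ is the set of reflection hyperplanes, $\mathcal{C}$ the set of $G$-orbits in $\mathcal{A}$; $e_C=e_H$ for $H\in C$. $\chi_H=\det|_{G_H}$. For each $H\in\mathcal{A}$ choose $\alpha_H\in V^*$ with kernel $H$. $P$ is the ring of complex polynomials on $V$, $P_m$ its homogeneous part of degree $m$, with $G$-action $p^g(x)=p(g^{-1}x)$; $P_{m,\tau}$ is the $\tau$-isotypic component of $P_m$ for $\tau\in\hat G$ (the set of irreducible complex representations of $G$). The parameters are $k=(k_{C,i})$ with $k_{C,i}\in\mathbb{C}$, $C\in\mathcal{C}$, $1\le i\le e_C-1$; $k_{H,i}=k_{C,i}$ if $H\in C$. Put $\epsilon_{H,i}=\frac1{e_H}\sum_{g\in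 G_H}\chi_H^i(g)g$ and $a_H(k)=\sum_{i=1}^{e_H-1}e_Hk_{H,i}\epsilon_{H,i}$. For $\xi\in V$, $T_\xi(k)=\partial_\xi+\sum_{H\in\mathcal{A}}\alpha_H(\xi)\alpha_H^{-1}a_H(k)$ acting on $P$, where $\partial_\xi$ is the directional derivative along $\xi$. The element $\sum_{H\in\mathcal{A}}a_H(k)$ is central in $\mathbb{C}[G]$, and $c_\tau(k)$ is the scalar by which it acts on $\tau$; it is a linear function of $k$ with nonnegative integer coefficients, not identically $0$ if $\tau$ is nontrivial. $k$ is called singular if there is a nonzero homogeneous polynomial $p\in P$ of positive degree with $T_\xi(k)p=0$ for all $\xi\in V$. $\mathbb{N}=\{1,2,3,\dots\}$. *)

(* Defs.v *)
From HB Require Import structures.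
From mathcomp Require Import all_boot all_order all_algebra all_fingroup.
From mathcomp Require Import all_character.
From mathcomp Require Import spectral complex.
From mathcomp Require Import boolp classical_sets cardinality reals.
From mathcomp Require Import mpoly.

Set Implicit Arguments.
Unset Strict Implicit.
Unset Printing Implicit Defensive.

Import GRing.Theory Num.Theory.
Local Open Scope ring_scope.

(* V = C^n is the space of column vectors 'cV[C]_n with its standard Hermitian
   inner product.  A finite subgroup of U(V) is given by a finite group G and a
   faithful representation rG of G by unitary matrices; g acts on V on the left,
   by v |-> rG g *m v. *)
Section ReflectionGroup.

Variables (R : realType) (n : nat) (gT : finGroupType) (G : {group gT}).
Local Notation C := (R[i]).
Local Notation V := ('cV[C]_n).
Local Notation P := ({mpoly C[n]}).
Variable rG : mx_representation C G n.

(* Ker (g - Id) *)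
Definition fixed_space (g : gT) : {vspace V} :=
  lker (linfun (mulmx (rG g - 1%:M) : V -> V)).

Definition is_hyperplane (H : {vspace V}) : bool := (\dim H).+1 == n.

(* Every element of G has finite order, G being finite. *)
Definition is_reflection (g : gT) : bool := is_hyperplane (fixed_space g).

Definition is_complex_reflection_group : Prop :=
  [/\ mx_faithful rG,
      forall g, g \in G -> rG g \is unitarymx
    & <<[set g in G | is_reflection g]>>%g = G].

(* The pointwise stabilizer G_H *)
Definition pstab (H : {vspace V}) : {set gT} :=
  [set g in G | (H <= fixed_space g)%VS].

(* An explicit finite enumeration of the reflection hyperplanes: H is a
   hyperplane with G_H nontrivial.  Restricting to subspaces of the form
   Ker (g - Id) loses nothing, see mem_refl_hyperplanes. *)
Definition refl_hyperplanes : seq {vspace V} :=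
  [seq H <- undup [seq fixed_space g | g <- enum G]
     | is_hyperplane H && (pstab H != [set 1%g])].

Lemma mem_refl_hyperplanes (H : {vspace V}) : mx_faithful rG ->
  (H \in refl_hyperplanes) = is_hyperplane H && (pstab H != [set 1%g]).
Proof.
move=> rGf; rewrite mem_filter andb_idr // => /andP[hH ntH].
have fix1 : fixed_space 1%g = fullv.
  apply/eqP; rewrite eqEsubv subvf; apply/subvP => v _.
  by rewrite memv_ker lfunE /= repr_mx1 subrr mul0mx.
have st1 : 1%g \in pstab H by rewrite inE group1 fix1 subvf.
have [g gst gn1] : exists2 g, g \in pstab H & g != 1%g.
  apply/exists_inP; rewrite -negb_forall_in; apply: contraNN ntH => /forall_inP h.
  apply/eqP/setP=> g; rewrite !inE -/(is_true _).
  apply/idP/eqP => [gst|->]; last by rewrite group1 fix1 subvf.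
  by apply/eqP/h; rewrite inE.
move: gst; rewrite inE => /andP[gG Hg].
rewrite mem_undup; apply/mapP; exists g; rewrite ?mem_enum //.
apply/eqP; rewrite eqEdim Hg /=.
have ltn_dim : (\dim (fixed_space g) < n)%N.
  have dV : \dim {:V} = n by rewrite dimvf /dim /= muln1.
  have le_dim : (\dim (fixed_space g) <= n)%N.
    by have := dimvS (subvf (fixed_space g)); rewrite dV.
  rewrite ltn_neqAle le_dim andbT.
  apply: contraNN gn1 => /eqP dg.
  have gT1 : fixed_space g = fullv.
    by apply/eqP; rewrite eqEdim subvf /= dV dg.
  have rg1 : rG g = 1%:M.
    apply/eqP; rewrite -subr_eq0; apply/eqP/matrixP => i j.
    have := memvf (delta_mx j ord0 : V); rewrite -gT1 memv_ker lfunE /= => /eqP.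
    rewrite -(mul1mx (rG g - 1%:M)) => /(congr1 (fun M : V => M i ord0)).
    by rewrite mul1mx -colE !mxE.
  have : g \in rker rG by rewrite inE gG rg1 mulmx1 eqxx.
  by move/(fintype.subsetP rGf); rewrite inE.
by rewrite -ltnS (eqP hH).
Qed.

(* The set of reflection hyperplanes as a finite type *)
Definition hyp : finType := seq_sub refl_hyperplanes.
Definition hspace (H : hyp) : {vspace V} := ssval H.
Definition stab (H : hyp) : {set gT} := pstab (hspace H).
Definition eH (H : hyp) : nat := #|stab H|.

(* The G-orbit of H, where g maps H to its image under rG g *)
Definition orbH (H : hyp) : {set hyp} :=
  [set H' | [exists g in G,
     hspace H' == (linfun (mulmx (rG g) : V -> V) @: hspace H)%VS]].

(* The set of G-orbits of reflection hyperplanes as a finite type *)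
Definition orbit_set : {set {set hyp}} := [set orbH H | H : hyp].
Definition hyporbit : finType := {O : {set hyp} | O \in orbit_set}.
Lemma orbH_in (H : hyp) : orbH H \in orbit_set.
Proof. exact: imset_f. Qed.
Definition orbit_of (H : hyp) : hyporbit := Sub (orbH H) (orbH_in H).

(* e_H is constant on each orbit, so the maximum is that common value. *)
Definition eC (O : hyporbit) : nat := \max_(H in val O) eH H.

(* Parameters k = (k_{C,i}), 1 <= i <= e_C - 1; the ordinal i : 'I_(eC O).-1
   stands for the index i.+1. *)
Definition pindex : finType := {O : hyporbit & 'I_(eC O).-1}.
Definition param := {ffun pindex -> C^o}.
Definition kH (k : param) (H : hyp) (i : 'I_(eC (orbit_of H)).-1) : C :=
  k (Tagged (fun O : hyporbit => 'I_(eC O).-1) i).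

(* Elements of C[G] are given by their coefficients. *)
Definition galg := {ffun gT -> C^o}.

(* The restriction of chi to G_H is the character chi_H. *)
Definition chi (g : gT) : C := \det (rG g).

Definition epsilon (H : hyp) (i : nat) : galg :=
  [ffun g => if g \in stab H then (eH H)%:R^-1 * chi g ^+ i else 0].

Definition aH (k : param) (H : hyp) : galg :=
  \sum_(i < (eC (orbit_of H)).-1) ((eH H)%:R * kH k i) *: epsilon H i.+1.

(* p^g(x) = p(g^-1 x) *)
Definition pact (g : gT) (p : P) : P :=
  p \mPo [tuple \sum_(j < n) rG g^-1%g i j *: 'X_j | i < n].

Definition galg_pact (z : galg) (p : P) : P := \sum_(g in G) z g *: pact g p.

Definition galg_mx d (tau : mx_representation C G d) (z : galg) : 'M[C]_d :=
  \sum_(g in G) z g *: tau g.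

(* Elements of V^* are row vectors. *)
Definition lform_val (a : 'rV[C]_n) (v : V) : C := (a *m v) ord0 ord0.
Definition lform_poly (a : 'rV[C]_n) : P := \sum_(i < n) a ord0 i *: 'X_i.

Definition is_root_choice (alpha : hyp -> 'rV[C]_n) : Prop :=
  forall (H : hyp) (v : V), v \in hspace H <-> lform_val (alpha H) v = 0.

Definition dird (xi : V) (p : P) : P := \sum_(i < n) xi i ord0 *: mderiv i p.

(* T_xi(k) p, computed in the fraction field of P, where alpha_H^-1 lives;
   for i >= 1 the image of epsilon_{H,i} consists of multiples of alpha_H, so
   that the value lies in P. *)
Definition dunkl (alpha : hyp -> 'rV[C]_n) (k : param) (xi : V) (p : P) :
    {fraction P} :=
  tofrac (dird xi p)
  + \sum_(H : hyp) tofrac (lform_val (alpha H) xi *: galg_pact (aH k H) p)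
                   / tofrac (lform_poly (alpha H)).

Definition Ksing (alpha : hyp -> 'rV[C]_n) : set param :=
  [set k | exists m (p : P),
     [/\ (0 < m)%N, p != 0, p \is m.-homog
       & forall xi : V, dunkl alpha k xi p = 0]]%classic.

(* \hat G: the finite type indexing the irreducible complex representations of
   G up to isomorphism; the irreducible representation of index t is irr_repr t,
   and principal_comp is the index of the trivial one. *)
Definition Ghat : irrType C G := DecSocleType (regular_repr C G).

(* The tau-isotypic component P_{m,tau} of P_m: the span of the images of all
   G-equivariant linear maps from tau to P_m. *)
Definition isotypic (m : nat) d (tau : mx_representation C G d) : set P :=
  [set p | exists N (f : 'I_N -> {linear 'cV[C]_d -> P}) (v : 'I_N -> 'cV[C]_d),
     [/\ forall j w, f j w \is m.-homog,
         forall j g w, g \in G -> f j (tau g *m w) = pact g (f j w)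
       & p = \sum_(j < N) f j (v j)]]%classic.

(* The scalar c_tau(k) by which the central element \sum_H a_H(k) acts on tau *)
Definition ctau d (tau : mx_representation C G d) (k : param) : C :=
  xget 0 [set c | galg_mx tau (\sum_(H : hyp) aH k H) = c%:M]%classic.

Definition Kmtau (m : nat) (t : Ghat) : set param :=
  [set k | m%:R + ctau (irr_repr t) k = 0]%classic.

Definition affine_hyperplane (K : set param) : Prop :=
  exists (l : {linear param -> C^o}) (b : C),
    (exists k, l k != 0) /\ K = [set k | l k = b]%classic.

End ReflectionGroup.

Arguments Kmtau {R n gT G} rG m t _.

(* Main.v *)
(* Write Z = sum_H a_H(k) = sum_g c_g g, where g |-> c_g is a class function. The
   commutator of T_xi with the multiplication by a linear form a is
   a(xi) + sum_g c_g a((g^-1 - 1) xi) g, and a linear operator on P that kills 1 is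
   determined by its commutators with the coordinates. Hence the T_xi commute and are
   G-equivariant, and sum_i x_i T_i = m + Z on P_m.
     If p of degree m > 0 is singular then Z p = - m p, so some isotypic component of p
   is nonzero and k lies on K_(m,tau). Conversely, as the T_xi commute, the recursion
   U_m p = (1/m) sum_i x_i U_(m-1) (T_i p) satisfies d_j U_m = U_(m-1) T_j, so U_m is
   not injective on P_m iff there is a singular polynomial of a degree in [1, m]. Its
   determinant F is a polynomial in k with F(0) = 1, whose zeros lie on finitely many
   hyperplanes K_(j,tau), none through 0. So F is a product of linear equations of such
   hyperplanes, and its zero set is the union of some of them.
     There are infinitely many: if Q is the product of alpha_H over an orbit C, then
   Q^(1 + |G| N) is singular for k_(C,1) = - (1 + |G| N) / e_C, the other parameters
   being 0, and a hyperplane that misses 0 meets the line of these k at most once. *)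

Require Import Defs.
From HB Require Import structures.
From mathcomp Require Import all_boot all_order all_algebra all_fingroup.
From mathcomp Require Import pgroup cyclic all_character.
From mathcomp Require Import spectral complex.
From mathcomp Require Import boolp classical_sets cardinality reals.
From mathcomp Require Import mpoly.

Set Implicit Arguments.
Unset Strict Implicit.
Unset Printing Implicit Defensive.

Import GRing.Theory Num.Theory.
Local Open Scope ring_scope.

(** * Functions with zeros on hyperplanes *)

Lemma horner_all0 (F : numDomainType) (p : {poly F}) :
  (forall t, p.[t] = 0) -> p = 0.
Proof.
move=> p0; apply/eqP/negPn/negP => /max_poly_roots max_p.
have := max_p [seq i%:R | i <- iota 0 (size p)].
rewrite size_map size_iota ltnn map_inj_uniq ?iota_uniq; last first.
  by move=> i j /eqP; rewrite eqr_nat => /eqP.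
have -> : all (root p) [seq i%:R | i <- iota 0 (size p)].
  by apply/allP => _ /mapP[i _ ->]; apply/eqP/p0.
by move=> /(_ isT isT).
Qed.

Section PolynomialOnLines.

Variables (F : numClosedFieldType) (W : lmodType F).

(** Being polynomial along each affine line is a coordinate-free substitute for being a polynomial
    function. It is stable under the operations used here and strong enough for products to have no
    zero divisors. *)
Definition poly_on_lines (f : W -> F) : Prop :=
  forall a b, exists p : {poly F}, forall t, f (a + t *: b) = p.[t].

Lemma poly_on_lines_cst c : poly_on_lines (fun=> c).
Proof. by move=> a b; exists c%:P => t; rewrite hornerC. Qed.

Lemma poly_on_lines_affine c (l : {linear W -> F^o}) :
  poly_on_lines (fun w => c + l w).
Proof.
move=> a b; exists ((c + l a)%:P + (l b)%:P * 'X) => t.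
by rewrite !hornerE linearD linearZ /= -addrA mulrC.
Qed.

Lemma poly_on_linesB f g :
  poly_on_lines f -> poly_on_lines g -> poly_on_lines (fun w => f w - g w).
Proof.
move=> fP gP a b; have [[p pE] [q qE]] := (fP a b, gP a b).
by exists (p - q) => t; rewrite !hornerE pE qE.
Qed.

Lemma poly_on_linesM f g :
  poly_on_lines f -> poly_on_lines g -> poly_on_lines (fun w => f w * g w).
Proof.
move=> fP gP a b; have [[p pE] [q qE]] := (fP a b, gP a b).
by exists (p * q) => t; rewrite !hornerE pE qE.
Qed.

Lemma poly_on_lines_prod (T : Type) (s : seq T) (f : T -> W -> F) :
  (forall i, poly_on_lines (f i)) -> poly_on_lines (fun w => \prod_(i <- s) f i w).
Proof.
move=> fP; elim: s => [|i s IHs].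
  by move=> a b; exists 1 => t; rewrite big_nil hornerE.
have := poly_on_linesM (fP i) IHs; congr poly_on_lines.
by apply/funext => w; rewrite big_cons.
Qed.

(** If [f a] and [g b] were nonzero, then on the line through [a] and [b] two nonzero one-variable
    polynomials would have product 0. *)
Lemma poly_on_lines_mul_eq0 f g : poly_on_lines f -> poly_on_lines g ->
  (forall w, f w * g w = 0) -> (forall w, f w = 0) \/ (forall w, g w = 0).
Proof.
move=> fP gP fg0; apply: contrapT => /not_orP[/existsNP[a fa] /existsNP[b gb]].
have [[p pE] [q qE]] := (fP a (b - a), gP a (b - a)).
have /eqP : p * q = 0 by apply: horner_all0 => t; rewrite hornerM -pE -qE.
rewrite mulf_eq0 => /orP[]/eqP r0.
  by apply: fa; rewrite -[a]addr0 -(scale0r (b - a)) pE r0 horner0.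
by apply: gb; rewrite -[b](subrK a) addrC -[b - a]scale1r qE r0 horner0.
Qed.

Lemma poly_on_lines_prod_eq0 (T : eqType) (s : seq T) (f : T -> W -> F) :
    (forall i, poly_on_lines (f i)) -> (forall w, \prod_(i <- s) f i w = 0) ->
  exists i, forall w, f i w = 0.
Proof.
move=> fP; elim: s => [/(_ 0)/eqP|i s IHs f0]; first by rewrite big_nil oner_eq0.
have [|||fi0|/IHs//] := @poly_on_lines_mul_eq0 (f i) (fun w => \prod_(j <- s) f j w).
- exact: fP.
- exact: poly_on_lines_prod.
- by move=> w; have := f0 w; rewrite big_cons.
- by exists i.
Qed.

(* On each line through 0 the one-variable polynomial t |-> f (t w) splits, so
   f w is a product of at most d of the values 1 + l_i w / c_i; which product it is
   depends on w, but there are finitely many candidates, so one works for all w. *)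
Lemma zeros_in_hyperplanes (I : finType) (c : I -> F) (l : I -> {linear W -> F^o}) d
    (f : W -> F) :
    (forall i, c i != 0) ->
    (forall a b, exists2 p : {poly F},
       (size p <= d.+1)%N & forall t, f (a + t *: b) = p.[t]) ->
    f 0 = 1 -> (forall w, f w = 0 -> exists i, c i + l i w = 0) ->
  forall w0, f w0 = 0 ->
    exists2 i, c i + l i w0 = 0 & forall w, c i + l i w = 0 -> f w = 0.
Proof.
move=> c0 fd f0 fz w0 fw0.
have fP : poly_on_lines f by move=> a b; have [p _ pE] := fd a b; exists p.
(* [None] is the factor 1. It pads shorter products to exactly [d] factors, so that the candidates
   form the finite type of [d]-tuples. *)
pose u (o : option I) w : F := if o is Some i then (c i)^-1 * (c i + l i w) else 1.
have uP o : poly_on_lines (u o).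
  case: o => [i|]; [| exact: poly_on_lines_cst].
  by apply: poly_on_linesM; [exact: poly_on_lines_cst | exact: poly_on_lines_affine].
pose v (s : d.-tuple (option I)) w : F := \prod_(o <- s) u o w.
have fv w : exists s, f w = v s w.
  have [p sz_p pE] := fd 0 w.
  have p0 : p.[0] = 1 by rewrite -pE scale0r addr0.
  have [r rE] := closed_field_poly_normal p.
  have lp0 : lead_coef p != 0.
    by apply/eqP => lp; move/eqP: p0; rewrite rE lp scale0r horner0 eq_sym oner_eq0.
  have sz_r : (size r <= d)%N.
    by rewrite -ltnS (leq_trans _ sz_p)// rE size_scale// size_prod_XsubC.
  have [s sE szE] : exists2 s, \prod_(z <- r) (1 - z^-1) = \prod_(o <- s) u o w
      & size s = size r.
    have: all (root p) r.
      apply/allP=> z zr; rewrite rE rootZ// root_prod_XsubC//.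
    elim: (r) => [|z r' IHr] /=; first by exists [::]; rewrite ?big_nil.
    case/andP=> /eqP pz /IHr[s sE <-].
    have z0 : z != 0 by apply: contra_eq_neq pz => ->; rewrite p0 oner_eq0.
    (* A root [z] of [p] gives the zero [z *: w] of [f]. The hyperplane through this point
       determines the factor [1 - z^-1]. *)
    have [i iE] : exists i, c i + l i (z *: w) = 0.
      by apply: fz; rewrite -[_ *: _]add0r pE.
    exists (Some i :: s); rewrite // !big_cons sE /=; congr (_ * _).
    have -> : l i w = - (c i / z).
      apply: (mulfI z0); rewrite mulrN mulrCA divff// mulr1.
      by apply/eqP; rewrite -addr_eq0 addrC; move/eqP: iE; rewrite linearZ.
    by rewrite mulrDr mulVf// mulrN mulKf.
  have szs : size (s ++ nseq (d - size r) None) == d by rewrite size_cat size_nseq szE subnKC.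
  exists (Tuple szs); rewrite /v big_cat /= [X in _ * X]big1_seq ?mulr1; last first.
    by move=> o /andP[_ /nseqP[->]].
  rewrite -sE -[w]scale1r -[1 *: w]add0r pE.
  (* Dividing by [p.[0] = 1] cancels the leading coefficient and leaves the product of the
     [1 - z^-1] over the roots. *)
  have -> : p.[1] = p.[1] / p.[0] by rewrite p0 divr1.
  rewrite {1 2}rE !hornerZ invfM mulrACA divff// mul1r !horner_prod -prodf_div.
  rewrite !big_seq; apply: eq_bigr => z zr; rewrite !hornerXsubC sub0r.
  have z0 : z != 0.
    apply/eqP => z0; move/eqP: p0; rewrite rE hornerZ horner_prod (big_rem z)//= z0.
    by rewrite hornerXsubC subrr mul0r mulr0 eq_sym oner_eq0.
  by rewrite invrN mulrN mulrBl mul1r divff// opprB.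
(* At each [w] some candidate agrees with [f], so the product of all differences vanishes
   identically, hence so does one of them. *)
have [s fE] : exists s, forall w, f w - v s w = 0.
  apply: (@poly_on_lines_prod_eq0 _ (enum {: d.-tuple (option I)}) (fun s w => f w - v s w)).
    by move=> s; apply: poly_on_linesB => //; apply: poly_on_lines_prod.
  move=> w; have [s sE] := fv w.
  by rewrite (big_rem s) ?mem_enum//= sE subrr mul0r.
have {}fE w : f w = v s w by apply/eqP; rewrite -subr_eq0 fE.
have := fw0; rewrite fE => /eqP; rewrite prodf_seq_eq0 => /hasP[[i|] si /=]; last first.
  by rewrite oner_eq0.
rewrite mulf_eq0 invr_eq0 (negPf (c0 i)) => /eqP liw0; exists i => // w liw; rewrite fE /v.
by apply/eqP; rewrite prodf_seq_eq0; apply/hasP; exists (Some i); rewrite //= liw mulr0.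
Qed.

End PolynomialOnLines.

(** * Linear substitutions in polynomials *)

Section LinearSubstitution.

Variables (R : realType) (n : nat).
Local Notation C := (R[i]).
Local Notation P := ({mpoly C[n]}).

Lemma mpolyX_ind (Q : nat -> P -> Prop) :
    Q 0%N 1 -> (forall d i p, Q d p -> Q d.+1 ('X_i * p)) ->
  forall m : 'X_{1..n}, Q (mdeg m) 'X_[m].
Proof.
move=> Q1 QX m; move dE : (mdeg m) => d; elim: d m dE => [|d IHd] m.
  by move=> /eqP; rewrite mdeg_eq0 => /eqP ->; rewrite mpolyX0.
move=> dE; have [i mi] : exists i, m i != 0%N.
  apply/existsP; rewrite -negb_forall; apply/negP => /forallP m0.
  by move: dE; rewrite mdegE big1 // => i _; apply/eqP.
have mE : m = (U_(i) + (m - U_(i)))%MM.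
  by rewrite addmC submK // lep1mP.
rewrite mE mpolyXD; apply: QX; apply: IHd.
by apply: succn_inj; rewrite -dE {2}mE mdegD mdeg1.
Qed.

(** The induction suited to linear operators that are known through their value at 1 and their
    commutators with the coordinates. *)
Lemma mpoly_mulX_ind (Q : P -> Prop) :
    Q 1 -> (forall i p, Q p -> Q ('X_i * p)) ->
    (forall c p q, Q p -> Q q -> Q (c *: p + q)) ->
  forall p, Q p.
Proof.
move=> Q1 QX Ql; have Q0 : Q 0 by have := Ql (-1) _ _ Q1 Q1; rewrite scaleN1r addNr.
elim/mpolyind => // c m p _ _ Qp; apply: Ql => //.
by apply: (mpolyX_ind (Q := fun=> Q)).
Qed.

Lemma dhomogXM i d p : p \is d.-homog -> ('X_i * p : P) \is d.+1.-homog.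
Proof. by move=> ph; rewrite -(add1n d); apply: dhomogM => //; rewrite dhomogX /= mdeg1. Qed.

Lemma dhomog_mulX_ind (Q : nat -> P -> Prop) :
    Q 0%N 1 -> (forall d i p, Q d p -> Q d.+1 ('X_i * p)) ->
    (forall d c p q, Q d p -> Q d q -> Q d (c *: p + q)) -> (forall d, Q d 0) ->
  forall d p, p \is d.-homog -> Q d p.
Proof.
move=> Q1 QX Ql Q0 d p ph; rewrite [p]mpolyE.
rewrite big_seq; elim/big_rec: _ => // m q mp Qq; apply: Ql => //.
by rewrite -(dhomog_mf ph mp); apply: mpolyX_ind.
Qed.

Lemma lform_poly_linear : linear (@lform_poly R n).
Proof.
move=> c a b; rewrite /lform_poly scaler_sumr -big_split; apply: eq_bigr => i _.
by rewrite !mxE scalerDl scalerA.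
Qed.

HB.instance Definition _ := GRing.isLinear.Build C ('rV[C]_n) P _ (@lform_poly R n)
  lform_poly_linear.

Lemma lform_polyZ c (a : 'rV[C]_n) : lform_poly (c *: a) = c *: lform_poly a.
Proof. exact: linearZ. Qed.

Lemma lform_polyX i : lform_poly (delta_mx 0 i) = 'X_i :> P.
Proof.
rewrite /lform_poly (bigD1 i)//= mxE !eqxx scale1r big1 ?addr0// => j /negPf ji.
by rewrite mxE ji andbF scale0r.
Qed.

Lemma mcoeff_lform_poly (a : 'rV[C]_n) i : (lform_poly a)@_U_(i) = a 0 i.
Proof.
rewrite raddf_sum (bigD1 i)//= mcoeffZ mcoeffX eqxx mulr1 big1 ?addr0// => j ji.
rewrite mcoeffZ mcoeffX; case: eqP => [/mnmP/(_ j)|]; last by rewrite mulr0.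
by rewrite !mnm1E eqxx eq_sym (negPf ji).
Qed.

Lemma lform_poly_inj : injective (@lform_poly R n).
Proof.
move=> a b ab; apply/rowP => i.
by rewrite -!mcoeff_lform_poly ab.
Qed.

Lemma lform_poly_eq0 (a : 'rV[C]_n) : (lform_poly a == 0) = (a == 0).
Proof.
apply/eqP/eqP => [a0|->]; last exact: linear0.
by apply: lform_poly_inj; rewrite a0 linear0.
Qed.

Lemma lform_poly_homog (a : 'rV[C]_n) : lform_poly a \is 1.-homog.
Proof.
by apply: rpred_sum => i _; apply: dhomogZ; rewrite dhomogX /= mdeg1.
Qed.

(* An operator defined as the witness of an opaque existence proof is not
   unfolded by unification, which would otherwise diverge. *)
Fact msubst_subproof (M : 'M[C]_n) : {f : P -> P | forall p,
  f p = p \mPo [tuple \sum_(j < n) M i j *: 'X_j | i < n]}.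
Proof. by exists (comp_mpoly [tuple \sum_(j < n) M i j *: 'X_j | i < n]). Qed.
Definition msubst M : P -> P := sval (msubst_subproof M).

Lemma msubstE M p : msubst M p = p \mPo [tuple \sum_(j < n) M i j *: 'X_j | i < n].
Proof. exact: (svalP (msubst_subproof M)). Qed.

Lemma msubstP M : linear (msubst M).
Proof. by move=> c p q; rewrite !msubstE linearP. Qed.

Lemma msubst_monoid M : monoid_morphism (msubst M).
Proof. by split=> [|p q]; rewrite !msubstE ?rmorph1 ?rmorphM. Qed.

HB.instance Definition _ M := GRing.isLinear.Build C P P _ (msubst M) (@msubstP M).
HB.instance Definition _ M := GRing.isMonoidMorphism.Build P P (msubst M) (@msubst_monoid M).

Lemma msubstD M p q : msubst M (p + q) = msubst M p + msubst M q.
Proof. exact: linearD. Qed.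

Lemma msubstM M p q : msubst M (p * q) = msubst M p * msubst M q.
Proof. exact: rmorphM. Qed.

Lemma msubst_1 M : msubst M 1 = 1.
Proof. exact: rmorph1. Qed.

Lemma msubstX M i : msubst M 'X_i = lform_poly (row i M).
Proof.
rewrite msubstE comp_mpolyXU nth_mktuple; apply: eq_bigr => j _.
by rewrite mxE.
Qed.

Lemma msubst_lform M a : msubst M (lform_poly a) = lform_poly (a *m M).
Proof.
rewrite raddf_sum /= mulmx_sum_row raddf_sum /=; apply: eq_bigr => i _.
by rewrite !linearZ /= msubstX.
Qed.

(** The order is reversed because [msubst M p] is the function sending x to p(Mx). *)
Lemma msubst_comp M N p : msubst M (msubst N p) = msubst (N *m M) p.
Proof.
elim/mpoly_mulX_ind: p => [|i p IHp|c p q IHp IHq]; first by rewrite !msubst_1.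
  by rewrite !msubstM !msubstX msubst_lform row_mul IHp.
by rewrite !msubstP IHp IHq.
Qed.

Lemma msubst1 p : msubst 1%:M p = p.
Proof.
elim/mpoly_mulX_ind: p => [|i p IHp|c p q IHp IHq]; first by rewrite !msubst_1.
  by rewrite !msubstM !msubstX row1 lform_polyX IHp.
by rewrite !msubstP IHp IHq.
Qed.

Lemma msubst_homog M d p : p \is d.-homog -> msubst M p \is d.-homog.
Proof.
move: d p; apply: dhomog_mulX_ind => [|d i p ph|d c p q ph qh|d].
- by rewrite msubst_1 dhomog1.
- rewrite msubstM msubstX -add1n; apply: dhomogM => //.
  exact: lform_poly_homog.
- by rewrite msubstP; apply: rpredD => //; apply: dhomogZ.
- by rewrite rmorph0 dhomog0.
Qed.

End LinearSubstitution.

(** * Reflection hyperplanes and their stabilizers *)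

(** The block matrix with rows (1, -a) and (u, 1) is a product of block triangular matrices in two
    ways; the determinants are compared. *)
Lemma det_add1_mul (K : comNzRingType) n (u : 'cV[K]_n) (a : 'rV[K]_n) :
  \det (1%:M + u *m a) = 1 + (a *m u) 0 0.
Proof.
have E1 : block_mx 1%:M (- a) u 1%:M =
    block_mx 1%:M 0 u 1%:M *m block_mx 1%:M (- a) 0 (1%:M + u *m a).
  rewrite mulmx_block !mul1mx !mulmx1 !mul0mx !addr0 mulmxN.
  by rewrite addrC addrK.
have E2 : block_mx 1%:M (- a) u 1%:M =
    block_mx (1%:M + a *m u) (- a) 0 1%:M *m block_mx 1%:M 0 u 1%:M.
  by rewrite mulmx_block !mul1mx !mulmx1 !mul0mx !mulmx0 !add0r mulNmx addrK.
have := congr1 determinant E1; rewrite E2 !det_mulmx !det_ublock !det_lblock.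
by rewrite !det1 !mul1r !mulr1 det_mx11 !mxE => <-.
Qed.

Section ReflectionGeometry.

Variables (R : realType) (n : nat) (gT : finGroupType) (G : {group gT}).
Local Notation C := (R[i]).
Local Notation V := ('cV[C]_n).
Local Notation P := ({mpoly C[n]}).
Variable rG : mx_representation C G n.
Local Notation hyp := (hyp rG).
Implicit Types (H : hyp) (g h : gT).

Lemma mem_fixed_space g v : (v \in fixed_space rG g) = (rG g *m v == v).
Proof. by rewrite memv_ker lfunE /= mulmxBl mul1mx subr_eq0. Qed.

Lemma pstabP (U : {vspace V}) g :
  reflect (g \in G /\ {in U, forall v, rG g *m v = v}) (g \in pstab rG U).
Proof.
rewrite inE; apply: (iffP andP) => -[gG Ug]; split=> //.
  by move=> v /(subvP Ug); rewrite mem_fixed_space => /eqP.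
by apply/subvP => v vU; rewrite mem_fixed_space Ug.
Qed.

Lemma pstab_group_set (U : {vspace V}) : group_set (pstab rG U).
Proof.
apply/group_setP; split=> [|g h /pstabP[gG gU] /pstabP[hG hU]]; apply/pstabP.
  by split=> // v _; rewrite repr_mx1 mul1mx.
split=> [|v vU]; first exact: groupM.
by rewrite repr_mxM// -mulmxA hU// gU.
Qed.
Canonical pstab_group U := Group (pstab_group_set U).

Lemma stab_sub H g : g \in stab H -> g \in G.
Proof. by case/pstabP. Qed.

Hypothesis rGf : mx_faithful rG.

Lemma hypP H : is_hyperplane (hspace H) /\ pstab rG (hspace H) != [set 1%g].
Proof. by apply/andP; rewrite -mem_refl_hyperplanes // (valP H). Qed.

Lemma eH_gt1 H : (1 < eH H)%N.
Proof.
have [_] := hypP H; apply: contraNT; rewrite -leqNgt => st1.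
by rewrite eq_sym eqEcard cards1 finset.sub1set (group1 (pstab_group _)).
Qed.

(** The default [H] of [insubd] is not reached when [h \in G], by [hspace_hact]. *)
Definition hact h H : hyp :=
  insubd H (linfun (mulmx (rG h) : V -> V) @: hspace H)%VS.

Lemma mem_img_repr (U : {vspace V}) h v : h \in G ->
  (v \in (linfun (mulmx (rG h) : V -> V) @: U)%VS) = (rG h^-1%g *m v \in U).
Proof.
move=> hG; apply/memv_imgP/idP => [[w wU ->]|vU].
  by rewrite lfunE /= mulmxA -repr_mxM ?groupV// mulVg repr_mx1 mul1mx.
exists (rG h^-1%g *m v) => //.
by rewrite lfunE /= mulmxA -repr_mxM ?groupV// mulgV repr_mx1 mul1mx.
Qed.

Lemma pstab_img (U : {vspace V}) h g : h \in G -> g \in G ->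
  (g \in pstab rG (linfun (mulmx (rG h) : V -> V) @: U)%VS)
    = ((g ^ h)%g \in pstab rG U).
Proof.
move=> hG gG; apply/pstabP/pstabP => -[_ gU]; split=> //; first exact: groupJ.
  move=> v vU; rewrite conjgE !repr_mxM ?groupM ?groupV// -!mulmxA gU.
    by rewrite mulmxA -repr_mxM ?groupV// mulVg repr_mx1 mul1mx.
  by rewrite mem_img_repr// mulmxA -repr_mxM ?groupV// mulVg repr_mx1 mul1mx.
move=> v; rewrite mem_img_repr// => /gU.
rewrite mulmxA -repr_mxM ?groupJ ?groupV// conjgE !mulgA mulgK => /(congr1 (mulmx (rG h))).
by rewrite !mulmxA -!repr_mxM ?groupM ?groupV// mulgA !mulgV mul1g repr_mx1 mul1mx.
Qed.

Lemma hspace_hact h H : h \in G ->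
  hspace (hact h H) = (linfun (mulmx (rG h) : V -> V) @: hspace H)%VS.
Proof.
move=> hG; rewrite -[LHS]/(val (hact h H)) insubdK//.
rewrite mem_refl_hyperplanes//; have [hH pH] := hypP H; apply/andP; split.
  rewrite /is_hyperplane limg_dim_eq//; apply/eqP; rewrite -subv0; apply/subvP => v.
  rewrite memv_cap memv_ker lfunE /= memv0 => /andP[_ /eqP rv0].
  by rewrite -[v]mul1mx -(repr_mx1 rG) -(mulVg h) repr_mxM ?groupV// -mulmxA rv0 mulmx0.
apply: contraNneq pH => p1; apply/eqP/setP => g; rewrite -/(hspace H).
have [gG|gG] := boolP (g \in G); last first.
  rewrite !inE (negPf gG) /=; apply/esym/negbTE.
  by apply: contraNneq gG => ->.
have gJ : (g ^ h^-1)%g \in G by rewrite groupJ ?groupV.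
by rewrite -[X in X \in pstab rG _](conjgKV h) -(pstab_img _ hG gJ) p1 !inE conjg_eq1.
Qed.

Lemma mem_hact h H v : h \in G -> (v \in hspace (hact h H)) = (rG h^-1%g *m v \in hspace H).
Proof. by move=> hG; rewrite hspace_hact// mem_img_repr. Qed.

Lemma hspace_inj : injective (@hspace _ _ _ _ rG).
Proof. exact: val_inj. Qed.

Lemma hactM g h H : g \in G -> h \in G -> hact g (hact h H) = hact (g * h) H.
Proof.
move=> gG hG; apply: hspace_inj; apply/vspaceP => v.
by rewrite !mem_hact ?groupM// invMg repr_mxM ?groupV// mulmxA.
Qed.

Lemma hact1 H : hact 1 H = H.
Proof.
by apply: hspace_inj; apply/vspaceP => v; rewrite mem_hact// invg1 repr_mx1 mul1mx.
Qed.

Lemma hactK h : h \in G -> cancel (hact h) (hact h^-1).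
Proof. by move=> hG H; rewrite hactM ?groupV// mulVg hact1. Qed.

Lemma orbHP H H' : reflect (exists2 g, g \in G & H' = hact g H) (H' \in orbH H).
Proof.
rewrite inE; apply: (iffP exists_inP) => -[g gG].
  by move/eqP => HE; exists g => //; apply: hspace_inj; rewrite hspace_hact.
by move=> ->; exists g; rewrite ?hspace_hact.
Qed.

Lemma orbit_of_hact h H : h \in G -> orbit_of (hact h H) = orbit_of H.
Proof.
move=> hG; apply: val_inj; apply/setP => H' /=.
apply/orbHP/orbHP => -[g gG ->].
  by exists (g * h)%g; rewrite ?groupM// hactM.
  have hVG : (h^-1)%g \in G by rewrite groupV.
  by exists (g * h^-1)%g; [exact: groupM | rewrite -hactM// hactK].
Qed.

Lemma mem_stab_hact h H g : h \in G -> g \in G ->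
  (g \in stab (hact h H)) = ((g ^ h)%g \in stab H).
Proof. by move=> hG gG; rewrite /stab hspace_hact// pstab_img. Qed.

Lemma stab_hact h H : h \in G -> stab (hact h H) = (stab H :^ h^-1)%g.
Proof.
move=> hG; apply/setP => g; rewrite mem_conjgV.
have [gG|gG] := boolP (g \in G); first exact: mem_stab_hact.
apply/idP/idP => /stab_sub; first by rewrite (negPf gG).
by rewrite memJ_norm ?(negPf gG)// (fintype.subsetP (normG G)).
Qed.

(** Stabilizers along an orbit are conjugate, so the maximum is taken over a constant function. *)
Lemma eC_orbit_of H : eC (orbit_of H) = eH H.
Proof.
have HH : H \in val (orbit_of H) by apply/orbHP; exists 1%g; rewrite ?hact1.
apply/eqP; rewrite eqn_leq (leq_bigmax_cond (P := mem (val (orbit_of H))))// andbT.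
by apply/bigmax_leqP => H' /orbHP[g gG ->]; rewrite /eH stab_hact// cardJg.
Qed.

Variable alpha : hyp -> 'rV[C]_n.
Hypothesis alphaP : is_root_choice alpha.

Lemma mem_hspaceE H v : (v \in hspace H) = (alpha H *m v == 0).
Proof.
apply/idP/eqP => [/alphaP|] aHv.
  by apply/matrixP => i j; rewrite !ord1 [RHS]mxE.
by apply/alphaP; rewrite /lform_val aHv mxE.
Qed.

Lemma alpha_neq0 H : alpha H != 0.
Proof.
have [hH _] := hypP H; apply: contraTneq hH => a0.
suff -> : hspace H = fullv by rewrite /is_hyperplane dimvf /dim /= muln1 neq_ltn ltnSn orbT.
by apply/vspaceP => v; rewrite mem_hspaceE a0 mul0mx eqxx memvf.
Qed.

Lemma alpha_dual H : exists v, alpha H *m v = 1%:M.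
Proof.
have /matrix0Pn[i [j aij]] := alpha_neq0 H; exists ((alpha H i j)^-1 *: delta_mx j 0).
rewrite -scalemxAr -colE; apply/matrixP => k l; rewrite !ord1 !mxE eqxx.
by rewrite mulVf// -(ord1 i).
Qed.

(** The matrix [1%:M - v0 *m alpha H] is the projection onto H along [v0], hence is killed by
    [A]. *)
Lemma eq_on_hspace H v0 m (A : 'M[C]_(m, n)) : alpha H *m v0 = 1%:M ->
  {in hspace H, forall v, A *m v = 0} -> A = A *m v0 *m alpha H.
Proof.
move=> av0 A0; apply/eqP; rewrite -subr_eq0 -mulmxA -{1}[A]mulmx1 -mulmxBr.
apply/eqP/matrixP => i j; rewrite [RHS]mxE.
have wH : (1%:M - v0 *m alpha H) *m delta_mx j (0 : 'I_1) \in hspace H.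
  by rewrite mem_hspaceE mulmxA mulmxBr mulmx1 mulmxA av0 mul1mx subrr mul0mx.
by have := A0 _ wH; rewrite mulmxA -colE => /colP/(_ i); rewrite mxE [RHS]mxE.
Qed.

Lemma stab_rank1 H v0 g : alpha H *m v0 = 1%:M -> g \in stab H ->
  rG g = 1%:M + (rG g - 1%:M) *m v0 *m alpha H.
Proof.
move=> av0 /pstabP[gG gH].
have <- : rG g - 1%:M = (rG g - 1%:M) *m v0 *m alpha H.
  by apply: eq_on_hspace => // v vH; rewrite mulmxBl mul1mx gH// subrr.
by rewrite addrC subrK.
Qed.

(** Writing g as 1 + u alpha_H, the eigenvalue on alpha_H is 1 + alpha_H(u), which is also the
    determinant of g. *)
Lemma alpha_stab H g : g \in stab H -> alpha H *m rG g = chi rG g *: alpha H.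
Proof.
move=> gH; have [v0 av0] := alpha_dual H.
rewrite /chi (stab_rank1 av0 gH) det_add1_mul mulmxDr mulmx1 mulmxA.
by rewrite scalerDl scale1r; congr (_ + _); rewrite [X in X *m _]mx11_scalar mul_scalar_mx.
Qed.

Lemma chiM g h : g \in G -> h \in G -> chi rG (g * h) = chi rG g * chi rG h.
Proof. by move=> gG hG; rewrite /chi repr_mxM// det_mulmx. Qed.

Lemma chi1 : chi rG 1 = 1.
Proof. by rewrite /chi repr_mx1 det1. Qed.

Lemma chiX g k : g \in G -> chi rG (g ^+ k) = chi rG g ^+ k.
Proof.
by move=> gG; elim: k => [|k IHk]; rewrite ?expg0 ?chi1// expgS chiM ?groupX// IHk exprS.
Qed.

Lemma chi_neq0 g : g \in G -> chi rG g != 0.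
Proof.
move=> gG; apply/eqP => g0; have := chi1; rewrite -(mulgV g) chiM ?groupV// g0 mul0r.
by move/eqP; rewrite eq_sym oner_eq0.
Qed.

Lemma chiJ g h : g \in G -> h \in G -> chi rG (g ^ h) = chi rG g.
Proof.
move=> gG hG; rewrite conjgE !chiM ?groupM ?groupV// mulrCA -chiM ?groupV//.
by rewrite mulVg chi1 mulr1.
Qed.

(* An element of G_H with determinant 1 is unipotent of finite order. *)
Lemma chi_stab_eq1 H g : g \in stab H -> chi rG g = 1 -> g = 1%g.
Proof.
move=> gH g1; have gG := stab_sub gH; have [v0 av0] := alpha_dual H.
pose u := (rG g - 1%:M) *m v0; have gE := stab_rank1 av0 gH; rewrite -/u in gE.
have au0 : alpha H *m u = 0.
  apply/matrixP => i j; rewrite !ord1 [RHS]mxE; apply: (addrI 1).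
  by rewrite -det_add1_mul -gE addr0.
have gXE k : rG (g ^+ k)%g = 1%:M + (u *m alpha H) *+ k.
  elim: k => [|k IHk]; first by rewrite expg0 repr_mx1 mulr0n addr0.
  rewrite expgS repr_mxM ?groupX// IHk gE mulmxDl mul1mx mulmxDr mulmx1.
  suff -> : u *m alpha H *m ((u *m alpha H) *+ k) = 0.
    by rewrite addr0 -addrA -mulrSr.
  by rewrite -scaler_nat -scalemxAr mulmxA -(mulmxA u) au0 mulmx0 mul0mx scaler0.
have ua0 : u *m alpha H = 0.
  apply/eqP; have := gXE #[g]%g; rewrite expg_order repr_mx1 -{1}[1%:M]addr0.
  move/addrI/esym/eqP; rewrite -scaler_nat scaler_eq0 pnatr_eq0 -leqn0 leqNgt.
  by rewrite order_gt0.
have : g \in rker rG by rewrite inE gG gE ua0 addr0 mulmx1 eqxx.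
by move/(fintype.subsetP rGf); rewrite inE => /eqP.
Qed.

(** The determinant is injective on G_H, and its e_H distinct values cannot all be roots of X^(i+1)
    - 1 when i + 1 < e_H. So the character summed here is nontrivial, and translation by a suitable
    [g0] multiplies the sum by a scalar other than 1. *)
Lemma sum_chi_stab H i : (i.+1 < eH H)%N -> \sum_(g in stab H) chi rG g ^+ i.+1 = 0.
Proof.
pose stab_group := pstab_group (hspace H).
move=> iH; have [g0 g0H g01] : exists2 g, g \in stab H & chi rG g ^+ i.+1 != 1.
  apply/exists_inP; rewrite -negb_forall_in; apply: contraL iH => /forall_inP chii.
  have chi_inj : {in stab H &, injective (chi rG)}.
    move=> g h gH hH gh; have hG := stab_sub hH.
    have ghH : (g * h^-1)%g \in stab H by rewrite (groupM (G := stab_group)) ?groupV.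
    apply/eqP; rewrite eq_mulgV1; apply/eqP; apply: (chi_stab_eq1 ghH).
    by rewrite chiM ?groupV ?(stab_sub gH)// gh -chiM ?groupV// mulgV chi1.
  rewrite -leqNgt /eH cardE -(size_map (chi rG)); apply: max_unity_roots => //.
    apply/allP => _ /mapP[g gH ->]; rewrite mem_enum in gH.
    by apply/unity_rootP/eqP/chii.
  by rewrite map_inj_in_uniq ?enum_uniq// => g h; rewrite !mem_enum; apply: chi_inj.
have g0G := stab_sub g0H; apply/eqP.
have : (chi rG g0 ^+ i.+1 - 1) * \sum_(g in stab H) chi rG g ^+ i.+1 == 0.
  rewrite mulrBl mul1r subr_eq0; apply/eqP.
  rewrite [RHS](reindex_inj (mulgI g0)) mulr_sumr /=; apply: eq_big => g.
    by rewrite (groupMl (G := stab_group)).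
  by move=> /stab_sub gG; rewrite chiM// exprMn.
by rewrite mulf_eq0 subr_eq0 (negPf g01).
Qed.

(** Both sides are nonzero linear forms that vanish on the image of H under h. *)
Lemma alpha_hact h H : h \in G ->
  exists2 c, c != 0 & alpha H *m rG h^-1%g = c *: alpha (hact h H).
Proof.
move=> hG; have [v0 av0] := alpha_dual (hact h H).
have aE := @eq_on_hspace (hact h H) v0 1 (alpha H *m rG h^-1%g) av0.
exists ((alpha H *m rG h^-1%g *m v0) 0 0).
  apply/eqP => c0; have := alpha_neq0 H.
  rewrite -[alpha H]mulmx1 -(repr_mx1 rG) -(mulVg h) repr_mxM ?groupV// mulmxA.
  rewrite aE; last first.
    by move=> v; rewrite mem_hact// mem_hspaceE mulmxA => /eqP.
  by rewrite [X in X *m _ *m _]mx11_scalar c0 mul_scalar_mx scale0r mul0mx eqxx.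
rewrite {1}aE; last by move=> v; rewrite mem_hact// mem_hspaceE mulmxA => /eqP.
by rewrite [X in X *m _]mx11_scalar mul_scalar_mx.
Qed.

End ReflectionGeometry.

(** * Dunkl operators on polynomials *)

Section DunklOperators.

Variables (R : realType) (n : nat) (gT : finGroupType) (G : {group gT}).
Local Notation C := (R[i]).
Local Notation V := ('cV[C]_n).
Local Notation P := ({mpoly C[n]}).
Variable rG : mx_representation C G n.
Local Notation hyp := (hyp rG).
Local Notation param := (param rG).
Local Notation hact := (@hact R n gT G rG).
Implicit Types (H : hyp) (g h : gT) (k : param) (xi : V) (p q : P).

Local Notation act g := (msubst (rG g^-1%g)).

Lemma pactE g p : pact rG g p = act g p.
Proof. by rewrite msubstE. Qed.

Lemma galg_pactE (z : galg R gT) p : galg_pact rG z p = \sum_(g in G) z g *: act g p.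
Proof. by apply: eq_bigr => g _; rewrite pactE. Qed.

Lemma repr_actM g h p : g \in G -> h \in G -> act g (act h p) = act (g * h)%g p.
Proof.
move=> gG hG; rewrite msubst_comp invMg.
by rewrite (repr_mxM rG (groupVr hG) (groupVr gG)).
Qed.

Lemma repr_act1 p : act 1%g p = p.
Proof. by rewrite invg1 repr_mx1 msubst1. Qed.

(* The coefficient at g of a_H(k), for g in G_H and H in the orbit O *)
Definition orbit_coef k (O : hyporbit rG) g : C :=
  \sum_(i < (eC O).-1) k (Tagged (fun O : hyporbit rG => 'I_(eC O).-1) i) * chi rG g ^+ i.+1.

Hypothesis rGf : mx_faithful rG.

Lemma aHE k H g : aH k H g = if g \in stab H then orbit_coef k (orbit_of H) g else 0.
Proof.
rewrite /aH sum_ffunE; case: ifPn => gH; last first.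
  by rewrite big1// => i _; rewrite !ffunE (negPf gH) scaler0.
apply: eq_bigr => i _; rewrite !ffunE gH.
rewrite -[_ *: _]/(_ * _) mulrACA divff ?mul1r//.
by rewrite pnatr_eq0 -lt0n ltnW// eH_gt1.
Qed.

Variable alpha : hyp -> 'rV[C]_n.
Hypothesis alphaP : is_root_choice alpha.

(** Only the powers chi_H^i with 0 < i < e_H occur, and each sums to 0 over G_H. Consequently the
    Dunkl operators kill constants. *)
Lemma sum_aH k H : \sum_(g in G) aH k H g = 0.
Proof.
rewrite (eq_bigr (fun g => \sum_(i < (eC (orbit_of H)).-1)
  if g \in stab H then kH k i * chi rG g ^+ i.+1 else 0)); last first.
  by move=> g _; rewrite aHE; case: ifP => // _; rewrite big1.
rewrite exchange_big big1//= => i _; rewrite -big_mkcondr /=.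
rewrite (eq_bigl (fun g => g \in stab H)) => [|g]; last first.
  by apply: andb_idl; apply: stab_sub.
rewrite -mulr_sumr (sum_chi_stab rGf alphaP) ?mulr0// -eC_orbit_of//.
by rewrite -ltn_predRL.
Qed.

Fact asum_subproof k : {z : gT -> C | forall g, z g = (\sum_(H : hyp) aH k H) g}.
Proof. by exists (\sum_(H : hyp) aH k H). Qed.

Definition asum k : gT -> C := sval (asum_subproof k).

Lemma asum_def k g : asum k g = \sum_(H : hyp) aH k H g.
Proof. by rewrite /asum (svalP (asum_subproof k)) sum_ffunE. Qed.

Fact dunkl_comm_subproof k xi (a : 'rV[C]_n) : {f : P -> P | forall p,
  f p = lform_val a xi *: p
    + \sum_(g in G) (asum k g * lform_val (a *m (rG g^-1%g - 1%:M)) xi) *: act g p}.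
Proof.
by exists (fun p => lform_val a xi *: p
  + \sum_(g in G) (asum k g * lform_val (a *m (rG g^-1%g - 1%:M)) xi) *: act g p).
Qed.

(* The commutator of T_xi(k) with multiplication by the linear form a *)
Definition dunkl_comm k xi a : P -> P := sval (dunkl_comm_subproof k xi a).

Lemma dunkl_commE k xi a p : dunkl_comm k xi a p = lform_val a xi *: p
  + \sum_(g in G) (asum k g * lform_val (a *m (rG g^-1%g - 1%:M)) xi) *: act g p.
Proof. exact: (svalP (dunkl_comm_subproof k xi a)). Qed.

Lemma dird_lformM xi a p :
  dird xi (lform_poly a * p) = lform_val a xi *: p + lform_poly a * dird xi p.
Proof.
have dX i : mderiv i (lform_poly a) = (a 0 i)%:MP.
  rewrite /lform_poly raddf_sum /= (bigD1 i)//= big1 ?addr0 => [|j ji].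
    have Uii : (U_(i) - U_(i) = 0)%MM by apply/mnmP => j; rewrite mnmBE subnn mnm0E.
    by rewrite mderivZ mderivX mnm1E eqxx Uii mpolyX0 scale1r -mul_mpolyC mulr1.
  by rewrite mderivZ mderivX mnm1E (negPf ji) mulr0n !scale0r scaler0.
rewrite /dird mulr_sumr /lform_val mxE scaler_suml -big_split /=.
apply: eq_bigr => i _.
by rewrite mderivM dX scalerDr mul_mpolyC scalerA [xi i _ * _]mulrC -scalerAr.
Qed.

(** The derivative contributes a(xi). For g in G_H, moving a past g changes it by a(g^-1 - 1), a
    multiple of alpha_H, so the denominator cancels and the commutator is polynomial. *)
Lemma dunkl_lformM k xi a p : dunkl alpha k xi (lform_poly a * p) =
  tofrac (lform_poly a) * dunkl alpha k xi p + tofrac (dunkl_comm k xi a p).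
Proof.
rewrite dunkl_commE /dunkl dird_lformM mulrDr mulr_sumr !rmorphD /= !rmorphM /=.
suff E H : tofrac (lform_val (alpha H) xi *: galg_pact rG (aH k H) (lform_poly a * p))
    / tofrac (lform_poly (alpha H)) =
  tofrac (lform_poly a) * (tofrac (lform_val (alpha H) xi *: galg_pact rG (aH k H) p)
    / tofrac (lform_poly (alpha H))) +
  tofrac (\sum_(g in G) (aH k H g * lform_val (a *m (rG g^-1%g - 1%:M)) xi) *: act g p).
  have <- : \sum_H \sum_(g in G)
        (aH k H g * lform_val (a *m (rG g^-1%g - 1%:M)) xi) *: act g p
      = \sum_(g in G) (asum k g * lform_val (a *m (rG g^-1%g - 1%:M)) xi) *: act g p.
    rewrite exchange_big; apply: eq_bigr => g _.
    by rewrite -scaler_suml -mulr_suml asum_def.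
  rewrite (eq_bigr _ (fun H _ => E H)) big_split /= -rmorph_sum /=.
  by rewrite [X in X + _ = _]addrC addrACA.
have aH0 : tofrac (lform_poly (alpha H)) != 0 :> {fraction P}.
  by rewrite tofrac_eq0 lform_poly_eq0 alpha_neq0.
apply: (mulIf aH0); rewrite divfK// mulrDl -mulrA divfK// -!tofracM -tofracD.
congr (tofrac _); rewrite !galg_pactE !scaler_sumr mulr_sumr.
rewrite [X in _ = _ + X]mulr_suml -big_split /=.
apply: eq_bigr => g gG; rewrite aHE; case: ifPn => gH; last first.
  by rewrite mul0r !scale0r !scaler0 mul0r mulr0 addr0.
rewrite msubstM msubst_lform.
have [v0 av0] := alpha_dual rGf alphaP H.
(* The forms a(g^-1 - 1) and alpha_H are proportional, so evaluation at [xi] can be exchanged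
   between them. This brings out the factor alpha_H to be cancelled. *)
have aE : lform_val (alpha H) xi *: lform_poly (a *m (rG g^-1%g - 1%:M))
    = lform_val (a *m (rG g^-1%g - 1%:M)) xi *: lform_poly (alpha H).
  have gVH : (g^-1)%g \in stab H by rewrite (groupV (pstab_group rG (hspace H))).
  have -> : a *m (rG g^-1%g - 1%:M) = (a *m (rG g^-1%g - 1%:M) *m v0) *m alpha H.
    rewrite {1}(stab_rank1 alphaP av0 gVH) addrAC subrr add0r.
    by rewrite !mulmxA.
  rewrite [X in X *m alpha H]mx11_scalar mul_scalar_mx.
  move: (_ 0 0) => c; rewrite linearZ /= scalerA.
  by congr (_ *: _); rewrite /lform_val -scalemxAl [RHS]mxE mulrC.
have -> : a *m rG g^-1%g = a *m (rG g^-1%g - 1%:M) + a by rewrite mulmxBr mulmx1 subrK.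
move: (a *m (rG g^-1%g - 1%:M)) aE => b bE; set q := act g p.
rewrite [lform_poly _]linearD /= mulrDl !scalerDr addrC; congr (_ + _).
  set s := lform_val _ _ in bE *; set c := orbit_coef _ _ _.
  have -> : s *: (c *: (lform_poly b * q)) = c *: ((s *: lform_poly b) * q).
    by rewrite -scalerAl !scalerA mulrC.
  by rewrite bE -!scalerAl scalerA [q * _]mulrC.
by rewrite -!scalerAr.
Qed.

Lemma dunklP k xi c p q : dunkl alpha k xi (c *: p + q) =
  tofrac c%:MP * dunkl alpha k xi p + dunkl alpha k xi q.
Proof.
have dirdP : dird xi (c *: p + q) = c%:MP * dird xi p + dird xi q.
  rewrite mul_mpolyC /dird scaler_sumr -big_split; apply: eq_bigr => i _ /=.
  by rewrite linearP scalerDr !scalerA mulrC.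
have galgP z : galg_pact rG z (c *: p + q) = c%:MP * galg_pact rG z p + galg_pact rG z q.
  rewrite mul_mpolyC !galg_pactE scaler_sumr -big_split; apply: eq_bigr => i _ /=.
  by rewrite linearP scalerDr !scalerA mulrC.
rewrite /dunkl dirdP mulrDr mulr_sumr addrACA -big_split tofracD tofracM /=.
congr (_ + _); apply: eq_bigr => H _.
by rewrite galgP scalerDr scalerAr tofracD tofracM mulrDl mulrA.
Qed.

Lemma dunkl_1 k xi : dunkl alpha k xi 1 = 0.
Proof.
have -> : dunkl alpha k xi 1 = tofrac (dird xi 1) + 0.
  congr (_ + _); rewrite big1// => H _.
  rewrite galg_pactE (eq_bigr (fun g => aH k H g *: 1)) => [|g _]; last by rewrite msubst_1.
  by rewrite -scaler_suml sum_aH scale0r scaler0 tofrac0 mul0r.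
rewrite addr0 /dird big1 ?tofrac0// => i _.
by rewrite -mpolyC1 mderivC scaler0.
Qed.

Lemma dunkl_comm_homog k xi a d p : p \is d.-homog -> dunkl_comm k xi a p \is d.-homog.
Proof.
move=> ph; rewrite dunkl_commE; apply: rpredD; first exact: dhomogZ.
by apply: rpred_sum => g _; apply: dhomogZ; apply: msubst_homog.
Qed.

(** Divisibility by alpha_H need not be examined for each polynomial: the value at 1 and the
    commutators with the coordinates are polynomial, and this propagates. *)
Lemma dunkl_poly k xi p : exists q, tofrac q = dunkl alpha k xi p.
Proof.
elim/mpoly_mulX_ind: p => [|i p [q qE]|c p p' [q qE] [q' q'E]].
- by exists 0; rewrite dunkl_1 tofrac0.
- exists ('X_i * q + dunkl_comm k xi (delta_mx 0 i) p).
  by rewrite -lform_polyX dunkl_lformM -qE tofracD tofracM.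
- by exists (c%:MP * q + q'); rewrite dunklP -qE -q'E tofracD tofracM.
Qed.

Fact pdunkl_subproof k xi : {f : P -> P | forall p, tofrac (f p) = dunkl alpha k xi p}.
Proof. by have [f fE] := boolp.choice (dunkl_poly k xi); exists f. Qed.

(* T_xi(k) as an operator on polynomials *)
Definition pdunkl k xi : P -> P := sval (pdunkl_subproof k xi).

Lemma tofrac_pdunkl k xi p : tofrac (pdunkl k xi p) = dunkl alpha k xi p.
Proof. exact: (svalP (pdunkl_subproof k xi)). Qed.

Lemma tofrac_inj : injective (@tofrac P).
Proof. by move=> p q /eqP; rewrite tofrac_eq => /eqP. Qed.

Lemma pdunklP k xi : linear (pdunkl k xi).
Proof.
move=> c p q; apply: tofrac_inj.
rewrite tofrac_pdunkl dunklP -(tofrac_pdunkl k xi p) -(tofrac_pdunkl k xi q).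
by rewrite -tofracM -tofracD mul_mpolyC.
Qed.

HB.instance Definition _ k xi := GRing.isLinear.Build C P P _ (pdunkl k xi) (@pdunklP k xi).

Lemma pdunklD k xi p q : pdunkl k xi (p + q) = pdunkl k xi p + pdunkl k xi q.
Proof. exact: linearD. Qed.

Lemma pdunkl_1 k xi : pdunkl k xi 1 = 0.
Proof. by apply: tofrac_inj; rewrite tofrac_pdunkl dunkl_1 tofrac0. Qed.

Lemma pdunkl_lformM k xi a p :
  pdunkl k xi (lform_poly a * p) = lform_poly a * pdunkl k xi p + dunkl_comm k xi a p.
Proof.
apply: tofrac_inj; rewrite tofrac_pdunkl dunkl_lformM -(tofrac_pdunkl k xi p).
by rewrite -tofracM -tofracD.
Qed.

Lemma pdunklXM k xi i p :
  pdunkl k xi ('X_i * p) = 'X_i * pdunkl k xi p + dunkl_comm k xi (delta_mx 0 i) p.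
Proof. by rewrite -lform_polyX pdunkl_lformM. Qed.

Lemma pdunkl_homog k xi d p : p \is d.+1.-homog -> pdunkl k xi p \is d.-homog.
Proof.
(* The induction starts in degree 0, where lowering the degree has to mean that the operator gives
   0. *)
pose Q e p := p \is e.-homog /\
  (if e is e'.+1 then pdunkl k xi p \is e'.-homog else pdunkl k xi p = 0).
suff H : forall e q, q \is e.-homog -> Q e q by move=> /(H d.+1)[].
apply: dhomog_mulX_ind => {d p} [|d i p [ph Qp]|d c p q [ph Qp] [qh Qq]|d].
- by split; [exact: dhomog1 | exact: pdunkl_1].
- split; first exact: dhomogXM.
  rewrite pdunklXM; apply: rpredD; last exact: dunkl_comm_homog.
  case: d Qp {ph} => [->|d Th]; first by rewrite mulr0 dhomog0.
  exact: dhomogXM.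
- split; first by apply: rpredD => //; apply: dhomogZ.
  rewrite pdunklP; case: d Qp Qq {ph qh} => [-> ->|d Tp Tq]; first by rewrite scaler0 addr0.
  by apply: rpredD => //; apply: dhomogZ.
- split; first exact: dhomog0.
  by case: d => [|d]; rewrite linear0 ?dhomog0.
Qed.

End DunklOperators.

(** * Equivariance, commutativity and the Euler identity of Dunkl operators *)

Section DunklTheory.

Variables (R : realType) (n : nat) (gT : finGroupType) (G : {group gT}).
Local Notation C := (R[i]).
Local Notation V := ('cV[C]_n).
Local Notation P := ({mpoly C[n]}).
Variable rG : mx_representation C G n.
Local Notation hyp := (hyp rG).
Local Notation param := (param rG).
Local Notation hact := (@hact R n gT G rG).
Local Notation act g := (msubst (rG g^-1%g)).
Implicit Types (H : hyp) (g h : gT) (k : param) (xi : V) (p q : P).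

Lemma lform_valP (a : 'rV[C]_n) c xi eta :
  lform_val a (c *: xi + eta) = c * lform_val a xi + lform_val a eta.
Proof. by rewrite /lform_val mulmxDr -scalemxAr mxE [X in X + _]mxE. Qed.

Hypothesis rGf : mx_faithful rG.
Variable alpha : hyp -> 'rV[C]_n.
Hypothesis alphaP : is_root_choice alpha.
Local Notation T := (pdunkl rGf alphaP).

Let T1 := pdunkl_1 rGf alphaP.
Let TXM := pdunklXM rGf alphaP.
Let TlM := pdunkl_lformM rGf alphaP.
Let TP := pdunklP rGf alphaP.

Lemma asumE k g : asum k g = \sum_(H | g \in stab H) orbit_coef k (orbit_of H) g.
Proof.
by rewrite asum_def [RHS]big_mkcond; apply: eq_bigr => H _; rewrite aHE.
Qed.

Lemma orbit_coefP c k k' O g :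
  orbit_coef (c *: k + k') O g = c * orbit_coef k O g + orbit_coef k' O g.
Proof.
rewrite /orbit_coef mulr_sumr -big_split; apply: eq_bigr => i _ /=.
by rewrite !ffunE mulrDl mulrA.
Qed.

Lemma orbit_coefJ k O g h : g \in G -> h \in G -> orbit_coef k O (g ^ h)%g = orbit_coef k O g.
Proof. by move=> gG hG; apply: eq_bigr => i _; rewrite chiJ. Qed.

Lemma asumP c k k' g : asum (c *: k + k') g = c * asum k g + asum k' g.
Proof.
rewrite !asumE mulr_sumr -big_split; apply: eq_bigr => H _.
exact: orbit_coefP.
Qed.
Lemma asum0 g : asum (0 : param) g = 0.
Proof. by have := asumP (-1) 0 0 g; rewrite scaler0 addr0 mulN1r addNr. Qed.

(** The action of h permutes the hyperplanes within their orbits and conjugates their stabilizers,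
    while the determinant is a class function. *)
Lemma asumJ k g h : g \in G -> h \in G -> asum k (g ^ h)%g = asum k g.
Proof.
move=> gG hG; rewrite !asumE [RHS](reindex_inj (can_inj (hactK rGf hG))).
apply: eq_big => H; first by rewrite mem_stab_hact.
by move=> _; rewrite (orbit_of_hact rGf _ hG) orbit_coefJ.
Qed.

Lemma sum_asum k : \sum_(g in G) asum k g = 0.
Proof.
under eq_bigr => g _ do rewrite asum_def.
by rewrite exchange_big big1// => H _; apply: (sum_aH rGf alphaP).
Qed.

Definition asum_act k p : P := \sum_(g in G) asum k g *: act g p.

Lemma asum_actP k c p q : asum_act k (c *: p + q) = c *: asum_act k p + asum_act k q.
Proof.
rewrite /asum_act scaler_sumr -big_split; apply: eq_bigr => g _.
by rewrite msubstP scalerDr !scalerA mulrC.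
Qed.

HB.instance Definition _ k := GRing.isLinear.Build C P P _ (asum_act k) (asum_actP k).

Lemma memJG g h : h \in G -> ((g ^ h)%g \in G) = (g \in G).
Proof. by move=> hG; rewrite memJ_norm// (fintype.subsetP (normG G)). Qed.

Lemma act_conjV g h p : g \in G -> h \in G ->
  act (g ^ h^-1)%g (act h p) = act h (act g p).
Proof.
move=> gG hG; have gJ : (g ^ h^-1)%g \in G by rewrite memJG ?groupVr.
by rewrite (repr_actM rG _ gJ hG) (repr_actM rG _ hG gG) -conjgCV.
Qed.

Lemma asum_act_act k h p : h \in G -> asum_act k (act h p) = act h (asum_act k p).
Proof.
move=> hG; have hVG := groupVr hG.
rewrite /asum_act linear_sum (reindex_inj (conjg_inj h^-1%g)) /=.
apply: eq_big => [g|g]; rewrite memJG// => gG.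
by rewrite act_conjV// asumJ// linearZ.
Qed.

Lemma dunkl_comm_act k xi a h p : h \in G ->
  act h (dunkl_comm k xi a p) = dunkl_comm k (rG h *m xi) (a *m rG h^-1%g) (act h p).
Proof.
move=> hG; have hVG := groupVr hG.
have hVh : rG h^-1%g *m rG h = 1%:M by rewrite -repr_mxM// mulVg repr_mx1.
rewrite !dunkl_commE msubstD linear_sum [X in _ = _ + X](reindex_inj (conjg_inj h^-1%g)) /=.
congr (_ + _).
  by rewrite linearZ /lform_val !mulmxA -(mulmxA a) hVh mulmx1.
apply: eq_big => [g|g gG]; first by rewrite memJG.
rewrite act_conjV// asumJ// linearZ /=; congr (_ * _ *: _); rewrite /lform_val.
have gVG := groupVr gG.
have -> : ((g ^ h^-1)^-1 = h * g^-1 * h^-1)%g by rewrite -conjVg conjgE invgK mulgA.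
rewrite !repr_mxM ?groupM//; move: (rG g^-1%g) => M.
have E : rG h^-1%g *m (rG h *m M *m rG h^-1%g - 1%:M) *m rG h = M - 1%:M.
  by rewrite mulmxBr mulmxBl mulmx1 !mulmxA hVh mul1mx -mulmxA hVh mulmx1.
by rewrite -E !mulmxA.
Qed.

Lemma pdunkl_act k xi h p : h \in G -> act h (T k xi p) = T k (rG h *m xi) (act h p).
Proof.
move=> hG; elim/mpoly_mulX_ind: p => [|i p IHp|c p q IHp IHq].
- by rewrite msubst_1 !T1 linear0.
- rewrite TXM -(lform_polyX R i) msubstD !msubstM msubst_lform TlM IHp.
  by rewrite dunkl_comm_act.
- by rewrite TP !msubstP TP IHp IHq.
Qed.

Lemma dunkl_commPxi k c xi eta a p : dunkl_comm k (c *: xi + eta) a p =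
  c *: dunkl_comm k xi a p + dunkl_comm k eta a p.
Proof.
rewrite !dunkl_commE lform_valP scalerDl !scalerDr scaler_sumr addrACA -big_split /=.
rewrite !scalerA; apply: (congr1 (+%R _)); apply: eq_bigr => g _.
by rewrite lform_valP !scalerA -scalerDl mulrDr mulrCA.
Qed.

Lemma pdunklPxi k c xi eta p : T k (c *: xi + eta) p = c *: T k xi p + T k eta p.
Proof.
elim/mpoly_mulX_ind: p => [|i p IHp|b p q IHp IHq].
- by rewrite !T1 scaler0 addr0.
- by rewrite !TXM IHp dunkl_commPxi mulrDr !scalerDr addrACA -scalerAr.
- rewrite !TP IHp IHq !scalerDr addrACA !scalerA.
  by rewrite [b * c]mulrC.
Qed.

(** A nonzero coefficient puts g in some G_H. Then g - 1 and g^-1 - 1 both factor through alpha_H,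
    and each side is alpha_H(xi) alpha_H(eta) times the same vector. *)
Lemma asum_rank1 k g xi eta (a : 'rV[C]_n) : g \in G -> asum k g != 0 ->
  lform_val (a *m (rG g^-1%g - 1%:M)) xi *: (rG g *m eta - eta)
    = lform_val (a *m (rG g^-1%g - 1%:M)) eta *: (rG g *m xi - xi).
Proof.
move=> gG ag; have [H gH] : exists H, g \in stab H.
  apply/existsP; apply: contraNT ag; rewrite negb_exists => /forallP gn.
  by rewrite asumE big1// => H; rewrite (negPf (gn H)).
have [v0 av0] := alpha_dual rGf alphaP H.
have gVH : (g^-1)%g \in stab H by rewrite (groupV (pstab_group rG (hspace H))).
have E g' : g' \in stab H -> rG g' - 1%:M = (rG g' - 1%:M) *m v0 *m alpha H.
  by move=> g'H; rewrite {1}(stab_rank1 alphaP av0 g'H) addrAC subrr add0r.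
have E1 xi' : rG g *m xi' - xi' = lform_val (alpha H) xi' *: ((rG g - 1%:M) *m v0).
  rewrite -{2}[xi']mul1mx -mulmxBl [in LHS](E _ gH) -[LHS]mulmxA.
  by rewrite [alpha H *m xi']mx11_scalar mul_mx_scalar.
have E2 xi' : lform_val (a *m (rG g^-1%g - 1%:M)) xi'
    = lform_val (a *m (rG g^-1%g - 1%:M)) v0 * lform_val (alpha H) xi'.
  rewrite /lform_val [in LHS](E _ gVH) !mulmxA -[LHS]/((_ *m _ *m xi') 0 0) -mulmxA.
  by rewrite [X in X *m (alpha H *m xi')]mx11_scalar mul_scalar_mx mxE.
by rewrite !E1 !(E2 xi) !(E2 eta) !scalerA mulrAC.
Qed.

Lemma pdunkl0 k p : T k 0 p = 0.
Proof. by have := pdunklPxi k (-1) 0 0 p; rewrite scaler0 addr0 scaleN1r addNr. Qed.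

(** By the Jacobi identity this says that [T_xi, T_eta] commutes with multiplication by a. *)
Lemma pdunkl_comm_comm k xi eta a p :
  dunkl_comm k eta a (T k xi p) - T k xi (dunkl_comm k eta a p) =
  dunkl_comm k xi a (T k eta p) - T k eta (dunkl_comm k xi a p).
Proof.
(* The scalar part of the commutator drops out, and equivariance turns g T_xi - T_xi g into T_(g xi
   - xi) g. The result is symmetric in the two directions by [asum_rank1]. *)
have E xi' eta' : dunkl_comm k eta' a (T k xi' p) - T k xi' (dunkl_comm k eta' a p) =
    \sum_(g in G) asum k g *:
      T k (lform_val (a *m (rG g^-1%g - 1%:M)) eta' *: (rG g *m xi' - xi')) (act g p).
  rewrite !dunkl_commE linearP linear_sum /= opprD addrACA subrr add0r -sumrB.
  apply: eq_bigr => g gG; rewrite linearZ /= pdunkl_act// -!scalerA -!scalerBr.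
  congr (_ *: _).
  rewrite -[_ *: (rG g *m _ - _)]addr0 pdunklPxi pdunkl0 addr0; congr (_ *: _).
  by rewrite [rG g *m _ - _]addrC -[- xi']scaleN1r pdunklPxi scaleN1r addrC.
rewrite (E xi eta) (E eta xi); apply: eq_bigr => g gG.
have [ag0|ag] := eqVneq (asum k g) 0.
  by rewrite ag0 [LHS]scale0r [RHS]scale0r.
by rewrite (asum_rank1 _ _ _ gG ag).
Qed.

Lemma pdunklC k xi eta p : T k xi (T k eta p) = T k eta (T k xi p).
Proof.
elim/mpoly_mulX_ind: p => [|i p IHp|c p q IHp IHq].
- by rewrite !T1 !linear0.
- have E (X A B A' B' : P) : A - B = A' - B' -> X + A' + B = X + A + B'.
    by move/eqP; rewrite -!addrA subr_eq addrAC eq_sym subr_eq => /eqP ->.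
  rewrite (TXM k eta) (TXM k xi) !pdunklD (TXM k xi) (TXM k eta) IHp.
  exact/E/pdunkl_comm_comm.
- by rewrite !TP IHp IHq.
Qed.

(** Contracting the direction with x turns each value b(xi) into the form b itself. The outcome is a
    + [Z, a] applied to p, which is the commutator of the operator deg + Z with a. *)
Lemma sumX_dunkl_comm k a p :
  \sum_(i < n) 'X_i * dunkl_comm k (delta_mx i 0) a p =
  lform_poly a * p + (asum_act k (lform_poly a * p) - lform_poly a * asum_act k p).
Proof.
have lvE b i : lform_val b (delta_mx i 0) = b 0 i by rewrite /lform_val -colE mxE.
have E b q : \sum_(i < n) 'X_i * (lform_val b (delta_mx i 0) *: q) = lform_poly b * q.
  rewrite /lform_poly mulr_suml; apply: eq_bigr => i _.
  by rewrite lvE -scalerAr scalerAl.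
under eq_bigr => i _ do rewrite dunkl_commE mulrDr.
rewrite big_split E; congr (_ + _).
under eq_bigr => i _ do rewrite mulr_sumr.
rewrite exchange_big /asum_act mulr_sumr -sumrB; apply: eq_bigr => g _ /=.
rewrite -scalerAr -scalerBr msubstM msubst_lform -mulrBl.
have <- : lform_poly (a *m (rG g^-1%g - 1%:M)) = lform_poly (a *m rG g^-1%g) - lform_poly a.
  by rewrite mulmxBr mulmx1 linearB.
by rewrite -E scaler_sumr; apply: eq_bigr => i _; rewrite scalerAr scalerA.
Qed.

Lemma asum_act_1 k : asum_act k 1 = 0.
Proof.
rewrite /asum_act; under eq_bigr => g _ do rewrite msubst_1.
by rewrite -scaler_suml sum_asum scale0r.
Qed.

Lemma asum_act_0 k : asum_act k 0 = 0.
Proof. by rewrite /asum_act big1// => g _; rewrite linear0 scaler0. Qed.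

Lemma pdunkl_euler k d p : p \is d.-homog ->
  \sum_(i < n) 'X_i * T k (delta_mx i 0) p = d%:R *: p + asum_act k p.
Proof.
move: d p; apply: dhomog_mulX_ind => [|d j p IHp|d c p q IHp IHq|d].
- by rewrite asum_act_1 scale0r addr0 big1// => i _; rewrite T1 mulr0.
- under eq_bigr => i _ do rewrite TXM mulrDr mulrCA.
  rewrite big_split /= -mulr_sumr IHp sumX_dunkl_comm lform_polyX.
  have E (x y a f : P) : x + y + (a + (f - y)) = x + a + f.
    by rewrite addrACA [y + _]addrC subrK.
  by rewrite mulrDr -scalerAr E -[d.+1]addn1 natrD scalerDl scale1r.
- under eq_bigr => i _ do rewrite TP mulrDr -scalerAr.
  by rewrite big_split /= -scaler_sumr IHp IHq asum_actP !scalerDr addrACA !scalerA mulrC.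
- by rewrite asum_act_0 scaler0 addr0 big1// => i _; rewrite linear0 mulr0.
Qed.

Lemma dunkl_comm_affine k k' (t : C) xi a p : dunkl_comm (k + t *: k') xi a p =
  dunkl_comm k xi a p + t *: (dunkl_comm k' xi a p - dunkl_comm (0 : param) xi a p).
Proof.
have E (v : P) (F F1 F2 F3 : gT -> P) :
    (forall g, F g = F1 g + t *: (F2 g - F3 g)) ->
    v + \sum_(g in G) F g = v + \sum_(g in G) F1 g
      + t *: (v + \sum_(g in G) F2 g - (v + \sum_(g in G) F3 g)).
  move=> FE; rewrite opprD [X in t *: X]addrACA subrr add0r -sumrB scaler_sumr -addrA.
  by rewrite -big_split; congr (_ + _); apply: eq_bigr => g _; rewrite FE.
rewrite (dunkl_commE k) (dunkl_commE k') (dunkl_commE 0) (dunkl_commE (k + _)).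
apply: E => g; rewrite [k + _]addrC asumP asum0.
move: (lform_val _ _) (act g p) (asum k g) (asum k' g) => l q x y.
by rewrite mul0r scale0r subr0 scalerA -scalerDl mulrDl mulrA addrC.
Qed.

(** The constant term of the affine dependence on the parameter is [T 0], so it is subtracted to
    leave the linear part in [k']. *)
Lemma pdunkl_affine k k' (t : C) xi p :
  T (k + t *: k') xi p = T k xi p + t *: (T k' xi p - T 0 xi p).
Proof.
elim/mpoly_mulX_ind: p => [|i p IHp|c p q IHp IHq].
- by rewrite !T1 subrr scaler0 addr0.
- rewrite !TXM IHp dunkl_comm_affine mulrDr -scalerAr mulrBr.
  by rewrite addrACA -scalerDr opprD [X in t *: X]addrACA.
- rewrite !TP IHp IHq scalerDr addrACA [c *: (t *: _)]scalerA [c * t]mulrC -scalerA -scalerDr.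
  by rewrite scalerBr opprD [X in t *: X]addrACA.
Qed.

End DunklTheory.

(** * The intertwining operator and its determinant *)

Section HomogeneousBasis.

Variables (K : comNzRingType) (n m : nat).

(** Monomials of degree m are cut out of those of degree at most m, which already form a finite
    type, so that they can index a matrix. *)
Definition hmnm : finType := {b : 'X_{1..n < m.+1} | mdeg b == m}.
Definition hmon (i : 'I_#|hmnm|) : 'X_{1..n} := val (val (enum_val i)).

Lemma mdeg_hmon i : mdeg (hmon i) = m.
Proof. exact: eqP (valP (enum_val i)). Qed.

Lemma hmon_inj : injective hmon.
Proof. by move=> i j /val_inj/val_inj/enum_val_inj. Qed.

Lemma hmon_surj b : mdeg b = m -> exists i, hmon i = b.
Proof.
move=> bm; have bm' : (mdeg b < m.+1)%N by rewrite bm.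
have bm2 : mdeg (BMultinom bm') == m by rewrite /= bm.
by exists (enum_rank (Sub (BMultinom bm') bm2 : hmnm)); rewrite /hmon enum_rankK.
Qed.

Definition hpoly (c : 'rV[K]_#|hmnm|) : {mpoly K[n]} := \sum_i c 0 i *: 'X_[hmon i].

Lemma mcoeff_hpoly c i : (hpoly c)@_(hmon i) = c 0 i.
Proof.
rewrite raddf_sum (bigD1 i)//= mcoeffZ mcoeffX eqxx mulr1 big1 ?addr0// => j ji.
by rewrite mcoeffZ mcoeffX (inj_eq hmon_inj) (negPf ji) mulr0.
Qed.

Lemma hpoly_homog c : hpoly c \is m.-homog.
Proof. by apply: rpred_sum => i _; apply: dhomogZ; rewrite dhomogX /= mdeg_hmon. Qed.

Lemma dhomog_eqP (p q : {mpoly K[n]}) : p \is m.-homog -> q \is m.-homog ->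
  (forall i, p@_(hmon i) = q@_(hmon i)) -> p = q.
Proof.
move=> ph qh pq; apply/mpolyP => b; have [/hmon_surj[i <-]//|bm] := eqVneq (mdeg b) m.
by rewrite (dhomog_nemf_coeff ph)// (dhomog_nemf_coeff qh).
Qed.

End HomogeneousBasis.

Section Intertwiner.

Variables (R : realType) (n : nat) (gT : finGroupType) (G : {group gT}).
Local Notation C := (R[i]).
Local Notation V := ('cV[C]_n).
Local Notation P := ({mpoly C[n]}).
Variable rG : mx_representation C G n.
Local Notation hyp := (hyp rG).
Local Notation param := (param rG).
Implicit Types (k : param) (xi : V) (p q : P).
Hypothesis rGf : mx_faithful rG.
Variable alpha : hyp -> 'rV[C]_n.
Hypothesis alphaP : is_root_choice alpha.
Local Notation T := (pdunkl rGf alphaP).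

Fact intertw_subproof k : {U : nat -> P -> P |
  (forall p, U 0%N p = p) /\
  forall m p, U m.+1 p = m.+1%:R^-1 *: \sum_(i < n) 'X_i * U m (T k (delta_mx i 0) p)}.
Proof.
by exists (fix U m p := if m is m'.+1 then
  m'.+1%:R^-1 *: \sum_(i < n) 'X_i * U m' (T k (delta_mx i 0) p) else p).
Qed.

(* The solution of d/dx_j o U = U o T_j(k) that is the identity in degree 0. *)
Definition intertw k : nat -> P -> P := sval (intertw_subproof k).
Local Notation U := intertw.

Lemma intertwn0 k p : U k 0 p = p.
Proof. exact: (svalP (intertw_subproof k)).1. Qed.

Lemma intertwS k m p :
  U k m.+1 p = m.+1%:R^-1 *: \sum_(i < n) 'X_i * U k m (T k (delta_mx i 0) p).
Proof. exact: (svalP (intertw_subproof k)).2. Qed.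

Lemma intertwP k m : linear (U k m).
Proof.
elim: m => [|m IHm] c p q; first by rewrite !intertwn0.
rewrite !intertwS.
rewrite (eq_bigr (fun i => c *: ('X_i * U k m (T k (delta_mx i 0) p))
    + 'X_i * U k m (T k (delta_mx i 0) q))) => [|i _]; last first.
  by rewrite pdunklP IHm mulrDr scalerAr.
by rewrite big_split -scaler_sumr /= scalerDr !scalerA mulrC.
Qed.

HB.instance Definition _ k m := GRing.isLinear.Build C P P _ (U k m) (@intertwP k m).

Lemma intertw_homog k m p : p \is m.-homog -> U k m p \is m.-homog.
Proof.
elim: m p => [|m IHm] p ph; rewrite ?intertwn0// intertwS.
apply: dhomogZ; apply: rpred_sum => i _.
exact/dhomogXM/IHm/pdunkl_homog.
Qed.

Lemma mderivXM (i j : 'I_n) p :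
  mderiv j ('X_i * p) = (i == j)%:R *: p + 'X_i * mderiv j p.
Proof.
rewrite mderivM mderivX mnm1E -scalerAl; case: eqP => [->|_]; last by rewrite !scale0r.
have -> : (U_(j) - U_(j) = 0)%MM by apply/mnmP => l; rewrite mnmBE subnn mnm0E.
by rewrite mpolyX0 mul1r.
Qed.

Lemma mderiv_sumX j (f : 'I_n -> P) :
  mderiv j (\sum_(i < n) 'X_i * f i) = f j + \sum_(i < n) 'X_i * mderiv j (f i).
Proof.
rewrite linear_sum /= (eq_bigr _ (fun i _ => mderivXM i j (f i))) big_split /=.
congr (_ + _); rewrite (bigD1 j)//= eqxx scale1r big1 ?addr0// => i /negPf ->.
by rewrite scale0r.
Qed.

Lemma mderiv_homog0 j p : p \is 0.-homog -> mderiv j p = 0.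
Proof.
move=> ph; apply/mpolyP => b; rewrite mcoeff_mderiv mcoeff0.
have bj : mdeg (b + U_(j)) != 0%N by rewrite mdegD mdeg1 addn1.
by rewrite (dhomog_nemf_coeff ph bj) mul0rn.
Qed.

(** Differentiating the recursion for U_(m+1) p gives U_m T_j p plus a sum which, by induction and
    commutativity of the T_i, is m U_m T_j p. The total m + 1 cancels the normalization. *)
Lemma mderiv_intertw k m j p : p \is m.+1.-homog ->
  mderiv j (U k m.+1 p) = U k m (T k (delta_mx j 0) p).
Proof.
elim: m p => [|m IHm] p ph; rewrite intertwS mderivZ mderiv_sumX.
  rewrite big1 => [|i _]; first by rewrite !intertwn0 invr1 scale1r addr0.
  rewrite intertwn0 mderiv_homog0 ?mulr0//; exact: pdunkl_homog.
have -> : \sum_(i < n) 'X_i * mderiv j (U k m.+1 (T k (delta_mx i 0) p))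
    = \sum_(i < n) 'X_i * U k m (T k (delta_mx i 0) (T k (delta_mx j 0) p)).
  apply: eq_bigr => i _.
  have Th : T k (delta_mx i 0) p \is m.+1.-homog by apply: pdunkl_homog.
  by rewrite (IHm _ Th) (pdunklC _ _ k (delta_mx j 0) (delta_mx i 0)).
have m0 : m.+1%:R != 0 :> C by rewrite pnatr_eq0.
have -> : \sum_(i < n) 'X_i * U k m (T k (delta_mx i 0) (T k (delta_mx j 0) p))
    = m.+1%:R *: U k m.+1 (T k (delta_mx j 0) p).
  by rewrite [in RHS]intertwS scalerA divff// scale1r.
rewrite -[X in X + _]scale1r -scalerDl -mulrS scalerA mulVf ?scale1r//.
by rewrite pnatr_eq0.
Qed.

(** Either p is singular, or some T_j p is nonzero and is again killed, since U_(m-1) T_j p = d_j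
    U_m p = 0. The descent stops before degree 0, where U is the identity. *)
Lemma intertw_ker k m p : p \is m.-homog -> p != 0 -> U k m p = 0 ->
  exists d q, [/\ (0 < d <= m)%N, q \is d.-homog, q != 0 & forall i, T k (delta_mx i 0) q = 0].
Proof.
elim: m p => [|m IHm] p ph p0 Up; first by rewrite -(intertwn0 k p) Up eqxx in p0.
have [Tp|/existsNP[j /eqP Tj]] := pselect (forall i, T k (delta_mx i 0) p = 0).
  by exists m.+1, p; rewrite ltnS leqnn.
have Th : T k (delta_mx j 0) p \is m.-homog by exact: pdunkl_homog.
have [|d [q [/andP[d0 dm] qh q0 Tq]]] := IHm _ Th Tj.
  by rewrite -mderiv_intertw// Up linear0.
by exists d, q; rewrite d0 (leq_trans dm).
Qed.

Lemma intertw_singular k d p :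
  (forall i, T k (delta_mx i 0) p = 0) -> U k d.+1 p = 0.
Proof. by move=> Tp; rewrite intertwS big1 ?scaler0// => i _; rewrite Tp linear0 mulr0. Qed.

(** At k = 0 the recursion reduces to Euler's identity for homogeneous polynomials. *)
Lemma intertw0 m p : p \is m.-homog -> U 0 m p = p.
Proof.
elim: m p => [|m IHm] p ph; rewrite ?intertwn0// intertwS.
under eq_bigr => i _ do rewrite IHm ?pdunkl_homog//.
rewrite (pdunkl_euler _ _ _ ph).
have -> : asum_act (0 : param) p = 0.
  by rewrite /asum_act big1// => g _; rewrite (asum0 rGf) scale0r.
by rewrite addr0 scalerA mulVf ?scale1r// pnatr_eq0.
Qed.

(** Each of the m Dunkl operators composed in U_m is affine in t, so the degree in t is at most m.
    The coefficients of [Q] are themselves polynomials on V. *)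
Lemma intertw_on_line k k' m p : exists Q : {poly P}, (size Q <= m.+1)%N /\
  forall t : C, U (k + t *: k') m p = Q.[t%:MP].
Proof.
elim: m p => [|m IHm] p.
  by exists p%:P; split=> [|t]; rewrite ?intertwn0 ?size_polyC_leq1 ?hornerC.
have [A AE] := boolp.choice (fun i => IHm (T k (delta_mx i 0) p)).
have [B BE] := boolp.choice (fun i => IHm (T k' (delta_mx i 0) p - T 0 (delta_mx i 0) p)).
exists (\sum_(i < n) (m.+1%:R^-1 *: 'X_i)%:P * (A i + 'X * B i)); split=> [|t].
  apply: (leq_trans (size_sum _ _ _)); apply/bigmax_leqP => i _.
  have [[sA _] [sB _]] := (AE i, BE i).
  rewrite mul_polyC (leq_trans (size_scale_leq _ _))//.
  rewrite (leq_trans (size_polyD _ _))// geq_max (leq_trans sA)//= mulrC.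
  by rewrite (leq_trans (size_polyMleq _ _))// size_polyX addn2.
rewrite intertwS horner_sum /= scaler_sumr; apply: eq_bigr => i _.
have [[_ EA] [_ EB]] := (AE i, BE i).
rewrite hornerM hornerC hornerD hornerM hornerX -EA -EB -scalerAl.
by rewrite pdunkl_affine linearD linearZ mul_mpolyC.
Qed.

Section Determinant.

Variable m : nat.
Local Notation N := #|hmnm n m|.
Local Notation hmon := (@hmon n m).

Definition intertw_mx k : 'M[C]_N := \matrix_(i, j) (U k m 'X_[hmon i])@_(hmon j).
Definition intertw_det k : C := \det (intertw_mx k).

Lemma mul_intertw_mx k (c : 'rV[C]_N) j :
  (c *m intertw_mx k) 0 j = (U k m (hpoly c))@_(hmon j).
Proof.
rewrite mxE /hpoly linear_sum raddf_sum /=; apply: eq_bigr => i _.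
by rewrite linearZ mxE mcoeffZ.
Qed.

Lemma intertw_det_eq0 k : intertw_det k = 0 ->
  exists d q, [/\ (0 < d <= m)%N, q \is d.-homog, q != 0 & forall i, T k (delta_mx i 0) q = 0].
Proof.
move/eqP/det0P => [c c0 cU]; apply: (@intertw_ker k m (hpoly c)).
- exact: hpoly_homog.
- apply: contraNneq c0 => c0; apply/eqP/rowP => i.
  by rewrite mxE -mcoeff_hpoly c0 mcoeff0.
- apply: (dhomog_eqP (m := m)) => [||j]; first exact/intertw_homog/hpoly_homog.
    exact: dhomog0.
  by rewrite -mul_intertw_mx cU mxE mcoeff0.
Qed.

Lemma singular_intertw_det k p : (0 < m)%N -> p \is m.-homog -> p != 0 ->
  (forall i, T k (delta_mx i 0) p = 0) -> intertw_det k = 0.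
Proof.
move=> m0 ph p0 Tp; apply/eqP/det0P; exists (\row_i p@_(hmon i)).
  apply: contraNneq p0 => r0; apply/eqP; apply: (dhomog_eqP ph) => [|i]; first exact: dhomog0.
  by have /rowP/(_ i) := r0; rewrite !mxE mcoeff0.
apply/rowP => j; rewrite mul_intertw_mx mxE.
rewrite (_ : hpoly _ = p); last first.
  by apply: (dhomog_eqP _ ph) => [|i]; [exact: hpoly_homog | rewrite mcoeff_hpoly mxE].
by case: m m0 j => // d _ j; rewrite intertw_singular// mcoeff0.
Qed.

Lemma intertw_det0 : intertw_det 0 = 1.
Proof.
rewrite /intertw_det (_ : intertw_mx 0 = 1%:M) ?det1//; apply/matrixP => i j.
rewrite !mxE intertw0; last by rewrite dhomogX /= mdeg_hmon.
by rewrite mcoeffX (inj_eq (@hmon_inj _ _)).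
Qed.

(** The determinant expands into products of N entries of degree at most m in t. That the bound is
    the same for all lines is what [zeros_in_hyperplanes] requires. *)
Lemma intertw_det_on_line k k' : exists2 p : {poly C}, (size p <= (N * m).+1)%N &
  forall t, intertw_det (k + t *: k') = p.[t].
Proof.
have [Q QE] := boolp.choice (fun i => intertw_on_line k k' m 'X_[hmon i]).
pose M : 'M[{poly C}]_N := \matrix_(i, j) \poly_(l < m.+1) ((Q i)`_l)@_(hmon j).
have sM i j : (size (M i j) <= m.+1)%N by rewrite mxE size_poly.
exists (\det M) => [|t].
  apply: (leq_trans (size_sum _ _ _)); apply/bigmax_leqP => s _.
  rewrite size_Msign (leq_trans (size_poly_prod_leq _ _))//= leq_subLR.
  rewrite card_ord addnS ltnS -mulnS.
  rewrite (leq_trans (leq_sum _ (fun i _ => sM i (s i))))//.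
  by rewrite sum_nat_const card_ord.
rewrite -[RHS]/(horner_eval t _) -det_map_mx; congr (\det _); apply/matrixP => i j.
have [sQ EQ] := QE i; rewrite /M !mxE EQ.
rewrite /= /horner_eval horner_poly (horner_coef_wide _ sQ) raddf_sum.
apply: eq_bigr => l _ /=.
by rewrite -(rmorphXn (@mpolyC n C)) mulrC mul_mpolyC mcoeffZ mulrC.
Qed.

End Determinant.

End Intertwiner.

(** * Isotypic components of singular polynomials *)

(** Translation by g fixes an element of G only if g = 1. *)
Lemma mxtrace_regular_repr (K : fieldType) (gT : finGroupType) (G : {group gT}) g :
  g \in G -> \tr (regular_repr K G g) = (#|G| * (g == 1%g))%:R.
Proof.
move=> gG; rewrite /mxtrace (eq_bigr (fun=> (g == 1%g)%:R)) => [|i _].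
  by rewrite sumr_const card_ord -mulrnA mulnC.
rewrite [regular_repr _ _ _]/= !mxE eqxx /=; congr (nat_of_bool _)%:R.
apply/eqP/eqP => [ig|->]; last by rewrite mulg1 gring_valK.
have := gring_indexK _ (groupM (enum_valP i) gG); rewrite -ig => /eqP.
by rewrite -{1}(mulg1 (enum_val i)) (can_eq (mulKg _)) => /eqP.
Qed.

Section Isotypic.

Variables (R : realType) (n : nat) (gT : finGroupType) (G : {group gT}).
Local Notation C := (R[i]).
Local Notation V := ('cV[C]_n).
Local Notation P := ({mpoly C[n]}).
Variable rG : mx_representation C G n.
Local Notation hyp := (hyp rG).
Local Notation param := (param rG).
Local Notation act g := (msubst (rG g^-1%g)).
Implicit Types (k : param) (p q : P) (t : Ghat R G).
Hypothesis rGf : mx_faithful rG.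
Variable alpha : hyp -> 'rV[C]_n.
Hypothesis alphaP : is_root_choice alpha.

Lemma pcharC_pgroup : ([pchar C]^'.-group G)%g.
Proof. by apply/pgroupP => p _ _; rewrite inE /= pchar_num. Qed.

Section Projection.

Variables (d : nat) (tau : mx_representation C G d) (p : P) (j : 'I_d).

(** The rank one map sending w to w_j p, made equivariant by summing its conjugates over G. *)
Definition isotypic_map (w : 'cV[C]_d) : P :=
  \sum_(g in G) (tau g^-1%g *m w) j 0 *: act g p.

Lemma isotypic_mapP : linear isotypic_map.
Proof.
move=> c v w; rewrite /isotypic_map scaler_sumr -big_split; apply: eq_bigr => g _.
by rewrite linearP !mxE scalerDl scalerA.
Qed.

HB.instance Definition _ := GRing.isLinear.Build C 'cV[C]_d P _ isotypic_map isotypic_mapP.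

Lemma isotypic_map_act g w : g \in G -> isotypic_map (tau g *m w) = act g (isotypic_map w).
Proof.
move=> gG; rewrite /isotypic_map linear_sum (reindex_inj (mulgI g)) /=.
apply: eq_big => [h|h hG]; first by rewrite groupMl.
rewrite groupMl// in hG.
have -> : tau (g * h)^-1%g *m (tau g *m w) = tau h^-1%g *m w.
  by rewrite mulmxA -repr_mxM ?groupVr ?groupM// invMg mulgKV.
by rewrite -(repr_actM rG _ gG hG); move: (_ *m w) => v; rewrite linearZ.
Qed.

Lemma isotypic_map_homog m w : p \is m.-homog -> isotypic_map w \is m.-homog.
Proof. by move=> ph; apply: rpred_sum => g _; apply/dhomogZ/msubst_homog. Qed.

End Projection.

(** The projection to the isotypic component, without its factor [irr_degree t] over [#|G|]. *)
Definition isotypic_part t p : P := \sum_(g in G) \tr (irr_repr t g^-1%g) *: act g p.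

Lemma isotypic_part_sum t p :
  isotypic_part t p = \sum_j isotypic_map (irr_repr t) p j (delta_mx j 0).
Proof.
rewrite /isotypic_part /isotypic_map exchange_big; apply: eq_bigr => g _ /=.
by rewrite -scaler_suml; congr (_ *: _); apply: eq_bigr => j _; rewrite -colE [RHS]mxE.
Qed.

Lemma isotypic_partP m t p : p \is m.-homog -> isotypic rG m (irr_repr t) (isotypic_part t p).
Proof.
move=> ph; exists (irr_degree t), (fun j => isotypic_map (irr_repr t) p j).
exists (fun j => delta_mx j 0).
split=> [j w|j g w gG|]; first exact: isotypic_map_homog.
  by rewrite pactE; apply: isotypic_map_act.
exact: isotypic_part_sum.
Qed.

(** The regular character is the sum of the irreducible ones weighted by their degrees, and it
    vanishes away from 1. So a nonzero p has a nonzero part. *)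
Lemma sum_isotypic_part p :
  \sum_t (irr_degree t)%:R *: isotypic_part t p = #|G|%:R *: p.
Proof.
have E g q : g \in G -> \sum_(t : Ghat R G) (irr_degree t)%:R *: (\tr (irr_repr t g^-1%g) *: q)
    = (#|G| * (g == 1%g))%:R *: q.
  move=> gG; have gVG := groupVr gG; rewrite -invg_eq1 -(mxtrace_regular_repr C gVG).
  rewrite (mxtrace_regular_pchar (Ghat R G) pcharC_pgroup _ gVG); last first.
    exact: group_closure_closed_field.
  by rewrite [RHS]scaler_suml; apply: eq_bigr => t _; rewrite scalerA mulr_natl.
rewrite /isotypic_part; under eq_bigr => t _ do rewrite scaler_sumr.
rewrite exchange_big (bigD1 1%g)//= [X in _ + X]big1 ?addr0 => [|g /andP[gG g1]].
  by rewrite E// eqxx muln1 repr_act1.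
by rewrite E// (negPf g1) muln0 scale0r.
Qed.

Lemma asum_act_isotypic_map k d (tau : mx_representation C G d) p j w :
  asum_act k (isotypic_map tau p j w) =
  isotypic_map tau p j (galg_mx tau (\sum_(H : hyp) aH k H) *m w).
Proof.
rewrite /galg_mx mulmx_suml [RHS]linear_sum; apply: eq_bigr => g gG.
by rewrite -scalemxAl linearZ /= isotypic_map_act// sum_ffunE -asum_def.
Qed.

Lemma galg_mx_asum_cent k d (tau : mx_representation C G d) :
  centgmx tau (galg_mx tau (\sum_(H : hyp) aH k H)).
Proof.
apply/centgmxP => h hG; rewrite /galg_mx mulmx_suml mulmx_sumr.
rewrite [RHS](reindex_inj (conjg_inj h)).
apply: eq_big => [g|g gG]; first by rewrite (memJG _ hG).
rewrite -scalemxAl -scalemxAr -(repr_mxM tau gG hG).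
by rewrite -(repr_mxM tau hG) ?groupJ// -conjgC !sum_ffunE -!asum_def (asumJ rGf).
Qed.

(** Schur's lemma supplies a scalar, so [xget] in the definition of [ctau] does not fall back on its
    default 0. *)
Lemma galg_mx_scalar k t :
  galg_mx (irr_repr t) (\sum_(H : hyp) aH k H) = (ctau (irr_repr t) k)%:M.
Proof.
rewrite /ctau; case: xgetP => [c _ ->//|].
have irrt : mx_irreducible (irr_repr t) by apply: socle_irr.
have /is_scalar_mxP[c cE] := mx_abs_irr_cent_scalar (group_closure_closed_field irrt)
  (galg_mx_asum_cent k (irr_repr t)).
by move=> /(_ c).
Qed.

(** The central element commutes with G, hence still acts by -m on the isotypic part, where it also
    acts by c_tau(k). *)
Lemma isotypic_part_eigen k m t p : asum_act k p = - (m%:R *: p) -> isotypic_part t p != 0 ->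
  m%:R + ctau (irr_repr t) k = 0.
Proof.
move=> pE q0; apply/eqP; move: q0; apply: contraNT => c0.
have H1 : asum_act k (isotypic_part t p) = - (m%:R *: isotypic_part t p).
  rewrite /isotypic_part linear_sum scaler_sumr -sumrN; apply: eq_bigr => g gG.
  rewrite linearZ /= (asum_act_act rGf _ _ gG) pE linearN linearZ /=.
  by rewrite scalerN !scalerA mulrC.
have H2 : asum_act k (isotypic_part t p) = ctau (irr_repr t) k *: isotypic_part t p.
  rewrite isotypic_part_sum linear_sum scaler_sumr; apply: eq_bigr => j _ /=.
  by rewrite asum_act_isotypic_map galg_mx_scalar mul_scalar_mx linearZ.
have /eqP : (m%:R + ctau (irr_repr t) k) *: isotypic_part t p = 0.
  by rewrite scalerDl -H2 H1 subrr.
by rewrite scaler_eq0 (negPf c0).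
Qed.

Lemma singular_isotypic k m p : p \is m.-homog -> p != 0 ->
    (forall i, pdunkl rGf alphaP k (delta_mx i 0) p = 0) ->
  exists t, m%:R + ctau (irr_repr t) k = 0 /\
    exists2 q, isotypic rG m (irr_repr t) q & q != 0.
Proof.
move=> ph p0 Tp; have pE : asum_act k p = - (m%:R *: p).
  apply/eqP; rewrite -addr_eq0 addrC -(pdunkl_euler rGf alphaP k ph).
  by rewrite big1// => i _; rewrite Tp mulr0.
have [t qt] : exists t, isotypic_part t p != 0.
  apply/not_existsP => q0; have := sum_isotypic_part p.
  rewrite big1 => [/esym/eqP|t _]; last first.
    by have /negP := q0 t; rewrite negbK => /eqP ->; rewrite scaler0.
  by rewrite scaler_eq0 (negPf p0) pnatr_eq0 -leqn0 leqNgt cardG_gt0.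
exists t; split; first exact: isotypic_part_eigen pE qt.
by exists (isotypic_part t p) => //; apply: isotypic_partP.
Qed.

Section CtauLinear.

Variables (d : nat) (tau : mx_representation C G d) (i0 : 'I_d).

(** A diagonal entry of the scalar matrix defining [ctau]: unlike the choice made by [xget], it is
    visibly linear in k. *)
Definition ctau_entry k : C^o := \sum_(g in G) asum k g * tau g i0 i0.

Lemma ctau_entryP : linear ctau_entry.
Proof.
move=> c k k'.
have -> : c *: ctau_entry k + ctau_entry k' = c * ctau_entry k + ctau_entry k' by [].
rewrite /ctau_entry mulr_sumr -big_split.
by apply: eq_bigr => g _; rewrite (asumP rGf) mulrDl mulrA.
Qed.

HB.instance Definition _ := GRing.isLinear.Build C param C^o _ ctau_entry ctau_entryP.

End CtauLinear.

Lemma ctau_linear t : exists l : {linear param -> C^o}, forall k, l k = ctau (irr_repr t) k.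
Proof.
have d0 : (0 < irr_degree t)%N := irr_degree_gt0 t.
exists (ctau_entry (irr_repr t) (Ordinal d0)) => k.
have /matrixP/(_ (Ordinal d0) (Ordinal d0)) := galg_mx_scalar k t.
rewrite [RHS]mxE eqxx mulr1n => <-; rewrite /galg_mx summxE.
by apply: eq_bigr => g _; rewrite [RHS]mxE sum_ffunE -asum_def.
Qed.

(** On the trivial representation the scalar is the sum of all coefficients. Hence m + c_tau(k) = 0
    has no solution there for m > 0. *)
Lemma ctau_principal k : ctau (irr_repr (principal_comp (Ghat R G))) k = 0.
Proof.
set t := principal_comp _; have d0 : (0 < irr_degree t)%N := irr_degree_gt0 t.
have := galg_mx_scalar k t; rewrite /galg_mx.
rewrite (eq_bigr (fun g => (asum k g)%:M)) => [|g gG].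
  rewrite -raddf_sum /= (sum_asum rGf alphaP) => /matrixP/(_ (Ordinal d0) (Ordinal d0)).
  by rewrite !mxE eqxx !mulr1n.
by rewrite sum_ffunE -asum_def irr1_repr// scalemx1.
Qed.

End Isotypic.

(** * Powers of semi-invariants as singular polynomials *)

Section SingularPowers.

Variables (R : realType) (n : nat) (gT : finGroupType) (G : {group gT}).
Local Notation C := (R[i]).
Local Notation V := ('cV[C]_n).
Local Notation P := ({mpoly C[n]}).
Variable rG : mx_representation C G n.
Local Notation hyp := (hyp rG).
Local Notation param := (param rG).
Local Notation act g := (msubst (rG g^-1%g)).
Local Notation hact := (@hact R n gT G rG).
Implicit Types (H : hyp) (k : param) (p q : P) (xi : V).
Hypothesis rGf : mx_faithful rG.
Variable alpha : hyp -> 'rV[C]_n.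
Hypothesis alphaP : is_root_choice alpha.

Lemma dirdM xi p q : dird xi (p * q) = dird xi p * q + p * dird xi q.
Proof.
rewrite /dird mulr_suml mulr_sumr -big_split; apply: eq_bigr => i _ /=.
by rewrite mderivM scalerDr scalerAl scalerAr.
Qed.

Lemma dird1 xi : dird xi 1 = 0.
Proof. by rewrite /dird big1// => i _; rewrite -mpolyC1 mderivC scaler0. Qed.

Lemma dird_lform xi a : dird xi (lform_poly a) = (lform_val a xi)%:MP.
Proof.
by have := dird_lformM xi a 1; rewrite mulr1 dird1 mulr0 addr0 -mul_mpolyC mulr1.
Qed.

Lemma dird_exp xi p M : dird xi (p ^+ M.+1) = M.+1%:R * (p ^+ M * dird xi p).
Proof.
elim: M => [|M IHM]; first by rewrite expr1 expr0 !mul1r.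
rewrite exprSr dirdM IHM -[M.+2]addn1 natrD mulrDl mul1r; congr (_ + _).
by rewrite [in RHS]exprSr -!mulrA [dird _ _ * _]mulrC.
Qed.

Lemma dird_prod xi (s : seq hyp) :
  tofrac (dird xi (\prod_(H <- s) lform_poly (alpha H))) =
  tofrac (\prod_(H <- s) lform_poly (alpha H)) *
  \sum_(H <- s) tofrac (lform_val (alpha H) xi)%:MP / tofrac (lform_poly (alpha H)).
Proof.
elim: s => [|H s IHs]; first by rewrite !big_nil dird1 tofrac0 mulr0.
have aH0 : tofrac (lform_poly (alpha H)) != 0 :> {fraction P}.
  by rewrite tofrac_eq0 lform_poly_eq0 (alpha_neq0 rGf alphaP).
rewrite !big_cons dirdM dird_lform tofracD !tofracM IHs mulrDr; congr (_ + _).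
  rewrite -mulrA [RHS]mulrCA; set a := tofrac (lform_poly _) in aH0 *.
  by rewrite [a * _]mulrC divfK// mulrC.
by rewrite mulrA.
Qed.

Variable H0 : hyp.
Local Notation O0 := (orbit_of H0).
Local Notation orb := [seq H <- enum hyp | orbit_of H == O0].

Definition orbit_prod : P := \prod_(H <- orb) lform_poly (alpha H).
Local Notation Q := orbit_prod.

Lemma orbit_prodE : Q = \prod_(H | orbit_of H == O0) lform_poly (alpha H).
Proof. by rewrite /orbit_prod big_filter big_enum_cond. Qed.

Lemma lform_alpha_neq0 H : lform_poly (alpha H) != 0.
Proof. by rewrite lform_poly_eq0 (alpha_neq0 rGf alphaP). Qed.

Lemma orbit_prod_neq0 : Q != 0.
Proof. by rewrite orbit_prodE; apply/prodf_neq0 => H _; apply: lform_alpha_neq0. Qed.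

Lemma orbit_prod_homog : exists2 d, (0 < d)%N & Q \is d.-homog.
Proof.
exists (size orb).
  by rewrite size_filter -has_count; apply/hasP; exists H0; rewrite ?mem_enum/=.
rewrite /orbit_prod; elim: orb => [|H s IHs] /=; first by rewrite big_nil dhomog1.
by rewrite big_cons -(add1n (size s)); apply: dhomogM => //; apply: lform_poly_homog.
Qed.

Lemma act_orbit_prod g : g \in G -> exists c, act g Q = c *: Q.
Proof.
move=> gG; have cE0 H : exists c, alpha H *m rG g^-1%g = c *: alpha (hact g H).
  by have [c _ E] := alpha_hact rGf alphaP H gG; exists c.
have [c cE] := boolp.choice cE0.
exists (\prod_(H | orbit_of H == O0) c H).
have QE : Q = \prod_(H | orbit_of H == O0) lform_poly (alpha (hact g H)).
  rewrite orbit_prodE (reindex_inj (can_inj (hactK rGf gG))).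
  by apply: eq_bigl => H; rewrite orbit_of_hact.
rewrite [in RHS]QE [in LHS]orbit_prodE rmorph_prod -scaler_prod; apply: eq_bigr => H _.
by rewrite /= msubst_lform cE lform_polyZ.
Qed.

(** The factor alpha_H is scaled by chi(g)^-1. The product [Q'] of the other factors is scaled by
    some constant, which is 1 because g fixes H pointwise and [Q'] does not vanish identically on
    H. *)
Lemma stab_orbit_prod H g : orbit_of H = O0 -> g \in stab H ->
  act g Q = (chi rG g)^-1 *: Q.
Proof.
move=> HO gH; have gG := stab_sub gH; have gVG := groupVr gG.
have gVH : (g^-1)%g \in stab H by rewrite (groupV (pstab_group rG (hspace H))).
have [c cE] := act_orbit_prod gG; rewrite cE; congr (_ *: _).
have chig : chi rG g^-1 = (chi rG g)^-1.
  by apply: (mulfI (chi_neq0 rG gG)); rewrite -chiM// mulgV chi1 divff ?chi_neq0.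
pose Q' := \prod_(H' | (orbit_of H' == O0) && (H' != H)) lform_poly (alpha H').
have QE : Q = lform_poly (alpha H) * Q' by rewrite orbit_prodE (bigD1 H) ?HO//=.
have cE' : act g Q' = (c * chi rG g) *: Q'.
  apply: (mulfI (lform_alpha_neq0 H)); apply: (scalerI (invr_neq0 (chi_neq0 rG gG))).
  rewrite scalerAl -chig -lform_polyZ -(alpha_stab rGf alphaP gVH).
  rewrite -msubst_lform -msubstM -QE cE QE.
  by rewrite -[in RHS]scalerAr [in RHS]scalerA chig mulrCA mulVf ?chi_neq0// mulr1.
have [v0 av0] := alpha_dual rGf alphaP H.
(* Substituting the projection [pi] onto H plays the part of restricting polynomials to H. *)
pose pi : 'M[C]_n := 1%:M - v0 *m alpha H.
have api : alpha H *m pi = 0 by rewrite mulmxBr mulmx1 mulmxA av0 mul1mx subrr.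
have gpi : rG g^-1%g *m pi = pi.
  rewrite (stab_rank1 alphaP av0 gVH) mulmxDl mul1mx; set u := _ *m v0.
  by rewrite -(mulmxA u) api mulmx0 addr0.
have Q'pi : msubst pi Q' != 0.
  rewrite rmorph_prod; apply/prodf_neq0 => H' /andP[_ nH] /=.
  rewrite msubst_lform lform_poly_eq0; apply: contraNneq nH => ap0.
  have aE : alpha H' = alpha H' *m v0 *m alpha H.
    by apply/eqP; rewrite -subr_eq0 -mulmxA -{1}[alpha H']mulmx1 -mulmxBr ap0.
  apply/eqP/hspace_inj/vspaceP => v; rewrite !(mem_hspaceE alphaP).
  have : alpha H' != 0 by apply: (alpha_neq0 rGf alphaP).
  rewrite aE [alpha H' *m v0]mx11_scalar mul_scalar_mx scaler_eq0 negb_or => /andP[d0 _].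
  by rewrite -scalemxAl scaler_eq0 (negPf d0).
have := congr1 (msubst pi) cE'; rewrite msubst_comp gpi linearZ /=.
move/eqP; rewrite -{1}[msubst pi Q']scale1r -subr_eq0 -scalerBl scaler_eq0 (negPf Q'pi) orbF.
rewrite subr_eq0 => /eqP cg1.
by apply: (mulIf (chi_neq0 rG gG)); rewrite -cg1 mulVf ?chi_neq0.
Qed.

End SingularPowers.

Section SingularLine.

Variables (R : realType) (n : nat) (gT : finGroupType) (G : {group gT}).
Local Notation C := (R[i]).
Local Notation V := ('cV[C]_n).
Local Notation P := ({mpoly C[n]}).
Variable rG : mx_representation C G n.
Local Notation hyp := (hyp rG).
Local Notation param := (param rG).
Local Notation act g := (msubst (rG g^-1%g)).
Implicit Types (H : hyp) (k : param) (p q : P) (xi : V).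
Hypothesis rGf : mx_faithful rG.
Variable alpha : hyp -> 'rV[C]_n.
Hypothesis alphaP : is_root_choice alpha.
Variable H0 : hyp.
Local Notation O0 := (orbit_of H0).
Local Notation Q := (orbit_prod alpha H0).

(* The basis parameter k_{C,1} = 1 of the orbit C of H0 *)
Definition first_param : param :=
  [ffun x : pindex rG => if (tag x == O0) && (nat_of_ord (tagged x) == 0%N) then 1 else 0].

Lemma orbit_coef_first_param t H g :
  orbit_coef (t *: first_param) (orbit_of H) g = if orbit_of H == O0 then t * chi rG g else 0.
Proof.
rewrite /orbit_coef; have e0 : (0 < (eC (orbit_of H)).-1)%N.
  by rewrite eC_orbit_of// -ltnS prednK ?eH_gt1// ltnW// eH_gt1.
case: ifPn => HO; last first.
  by rewrite big1// => i _; rewrite !ffunE /= (negPf HO) scaler0 mul0r.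
rewrite (bigD1 (Ordinal e0))//= [X in _ + X]big1 ?addr0 => [|i ine].
  by rewrite !ffunE /= HO expr1 -[_ *: _]/(t * 1) mulr1.
rewrite !ffunE /= HO /=; case: eqP => [i0|_]; last by rewrite scaler0 mul0r.
by case/eqP: ine; apply: val_inj.
Qed.

(** The exponent is 1 modulo the order of G, so g in G_H scales this power by chi(g)^-1, which
    cancels the coefficient t chi(g) up to t. On the other orbits a_H(k) is 0. *)
Lemma galg_pact_orbit_prod t H M :
  galg_pact rG (aH (t *: first_param) H) (Q ^+ (#|G| * M).+1)
  = (if orbit_of H == O0 then (eH H)%:R * t else 0) *: Q ^+ (#|G| * M).+1.
Proof.
rewrite galg_pactE; set k := _ *: _; set q := Q ^+ _.
rewrite (eq_bigr (fun g =>
    (if (g \in stab H) && (orbit_of H == O0) then t else 0) *: q)); last first.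
  move=> g gG; rewrite aHE// orbit_coef_first_param.
  case: ifPn => gH /=; last by rewrite !scale0r.
  case: eqP => HO; last by rewrite !scale0r.
  have qE : act g q = ((chi rG g)^-1 ^+ (#|G| * M).+1) *: q.
    by rewrite /q rmorphXn /= (stab_orbit_prod rGf alphaP HO gH) exprZn.
  rewrite qE scalerA; congr (_ *: _).
  rewrite exprS exprM exprVn -chiX// expg_cardG// chi1 invr1 expr1n mulr1.
  by rewrite -mulrA divff ?chi_neq0// mulr1.
rewrite -scaler_suml; congr (_ *: _); case: eqP => HO; last first.
  by rewrite big1// => g _; rewrite andbF.
under eq_bigr => g _ do rewrite andbT.
rewrite -big_mkcondr /= (eq_bigl (fun g => g \in stab H)) => [|g]; last first.
  by apply: andb_idl; apply: stab_sub.
by rewrite sumr_const mulr_natl.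
Qed.

(** With N the exponent, the logarithmic derivative gives N alpha_H(xi) / alpha_H for each H of the
    orbit, and the reflection term gives e_H t times the same quotient. The choice t = - N / e_H
    makes them cancel. *)
Lemma singular_line M :
  Ksing alpha ((- ((#|G| * M).+1%:R / (eH H0)%:R)) *: first_param).
Proof.
have [d d0 Qh] := orbit_prod_homog alpha H0.
exists (d * (#|G| * M).+1)%N, (Q ^+ (#|G| * M).+1); split.
- by rewrite muln_gt0 d0.
- by rewrite expf_neq0// (orbit_prod_neq0 rGf alphaP).
- exact: dhomogMn.
move=> xi; rewrite /dunkl; set N := (#|G| * M).+1; set t := - _.
have et H : orbit_of H = O0 -> (eH H)%:R * t = - N%:R.
  move=> HO; have -> : eH H = eH H0 by rewrite -(eC_orbit_of rGf H) HO eC_orbit_of.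
  by rewrite mulrN mulrC divfK// pnatr_eq0 -lt0n ltnW// eH_gt1.
pose S := \sum_(H | orbit_of H == O0)
  tofrac (lform_val (alpha H) xi)%:MP / tofrac (lform_poly (alpha H)).
have -> : tofrac (dird xi (Q ^+ N)) = tofrac (N%:R * Q ^+ N) * S.
  rewrite dird_exp [Q ^+ N]exprSr !tofracM (dird_prod rGf alphaP) -/Q.
  by rewrite /S -[RHS]mulrA -[in RHS]mulrA big_filter big_enum_cond.
rewrite (bigID (fun H => orbit_of H == O0)) /=.
rewrite [X in _ + (_ + X)]big1 => [|H /negPf HO]; last first.
  by rewrite galg_pact_orbit_prod HO scale0r scaler0 tofrac0 mul0r.
rewrite addr0 mulr_sumr -big_split big1// => H /eqP HO /=.
rewrite galg_pact_orbit_prod HO eqxx (et _ HO) mulrA -mulrDl -tofracM -tofracD.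
rewrite scaleNr scalerN -mul_mpolyC -[N%:R *: _]mul_mpolyC mpolyC_nat.
by rewrite mulrA [_%:MP * _]mulrC -mulrA [_ * _%:MP]mulrC mulrA subrr tofrac0 mul0r.
Qed.

End SingularLine.

(** * Hyperplanes of singular parameters *)

Section Corollary.

Variables (R : realType) (n : nat) (gT : finGroupType) (G : {group gT}).
Local Notation C := (R[i]).
Local Notation V := ('cV[C]_n).
Local Notation P := ({mpoly C[n]}).
Variable rG : mx_representation C G n.
Local Notation hyp := (hyp rG).
Local Notation param := (param rG).
Implicit Types (H : hyp) (k : param) (p q : P) (xi : V).
Hypothesis rGf : mx_faithful rG.
Variable alpha : hyp -> 'rV[C]_n.
Hypothesis alphaP : is_root_choice alpha.
Local Notation T := (pdunkl rGf alphaP).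

Lemma pdunkl_basis k p : (forall i, T k (delta_mx i 0) p = 0) -> forall xi, T k xi p = 0.
Proof.
move=> Tp xi; rewrite [xi]matrix_sum_delta; apply: (big_ind (fun eta => T k eta p = 0)).
- exact: pdunkl0.
- by move=> x y Tx Ty; rewrite -[x]scale1r pdunklPxi Tx Ty scaler0 addr0.
- move=> i _; rewrite big_ord1 -[_ *: _]addr0 pdunklPxi pdunkl0.
  by rewrite Tp scaler0 addr0.
Qed.

Lemma KsingP k : Ksing alpha k <-> exists m p,
  [/\ (0 < m)%N, p != 0, p \is m.-homog & forall i, T k (delta_mx i 0) p = 0].
Proof.
split=> -[m [p [m0 p0 ph Tp]]]; exists m, p; split=> //.
  by move=> i; apply: tofrac_inj; rewrite tofrac_pdunkl Tp tofrac0.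
by move=> xi; rewrite -(tofrac_pdunkl rGf alphaP) (pdunkl_basis Tp) tofrac0.
Qed.

Definition isotypic_neq0 m (t : Ghat R G) := exists2 p, isotypic rG m (irr_repr t) p & p != 0.

(** Applying [singular_isotypic] to p itself would give a hyperplane through k, but not its
    inclusion in the singular set. The determinant in the degree of p yields one that is included,
    possibly of smaller degree. *)
Lemma Ksing_cover k : Ksing alpha k -> exists m t,
  [/\ (0 < m)%N, isotypic_neq0 m t, Kmtau rG m t k & (Kmtau rG m t `<=` Ksing alpha)%classic].
Proof.
move=> /KsingP[m [p [m0 p0 ph Tp]]].
pose F := intertw_det rGf alphaP m.
have Fk : F k = 0 by apply: singular_intertw_det Tp.
have FK w : F w = 0 -> exists d t,
    [/\ (0 < d <= m)%N, isotypic_neq0 d t & d%:R + ctau (irr_repr t) w = 0].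
  case/intertw_det_eq0 => d [q [dm qh q0 Tq]].
  by have [t [tE tq]] := singular_isotypic qh q0 Tq; exists d, t.
(* A zero of the determinant yields a singular polynomial of degree at most m, so these finitely
   many pairs suffice. *)
pose I := {x : 'I_m.+1 * Ghat R G | `[< (0 < x.1)%N /\ isotypic_neq0 x.1 x.2 >]}.
have [L LE] := boolp.choice (@ctau_linear R n gT G rG rGf).
have cI0 (x : I) : (val x).1%:R != 0 :> C.
  by case: x => x /= /asboolP[x0 _]; rewrite pnatr_eq0 -lt0n.
have FI w : F w = 0 -> exists x : I, (val x).1%:R + L (val x).2 w = 0.
  case/FK => d [t [/andP[d0 dm] td tE]].
  have dm1 : (d < m.+1)%N by [].
  have xI : `[< (0 < (Ordinal dm1, t).1)%N /\ isotypic_neq0 (Ordinal dm1, t).1 t >].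
    exact/asboolP.
  by exists (Sub (Ordinal dm1, t) xI); rewrite /= LE.
have [[[d t] /= /asboolP[d0 td]] /= dk Kd] := zeros_in_hyperplanes cI0
  (intertw_det_on_line rGf alphaP m) (intertw_det0 rGf alphaP m) FI Fk.
exists d, t; split=> //; first by rewrite /Kmtau /= -LE.
move=> w; rewrite /Kmtau /= -LE => /Kd.
case/intertw_det_eq0 => e [q [/andP[e0 _] qh q0 Tq]].
by apply/KsingP; exists e, q.
Qed.

(** A point of the set shows that c_tau is not identically 0, as it takes the value -m there. *)
Lemma Kmtau_hyperplane m t k : (0 < m)%N -> Kmtau rG m t k -> affine_hyperplane (Kmtau rG m t).
Proof.
move=> m0 kK; have [l lE] := ctau_linear rGf t; exists l, (- m%:R); split.
  exists k; rewrite lE; apply: contraTneq m0 => c0.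
  by move/eqP: kK; rewrite /Kmtau /= c0 addr0 pnatr_eq0 -leqn0 -leqNgt.
apply/seteqP; split=> w; rewrite /Kmtau /= lE => /eqP.
  by rewrite addrC addr_eq0 => /eqP.
by rewrite -addr_eq0 addrC => /eqP.
Qed.

Lemma Kmtau_line_inj m t k (a b : C) : (0 < m)%N ->
  Kmtau rG m t (a *: k) -> Kmtau rG m t (b *: k) -> a = b.
Proof.
move=> m0; have [l lE] := ctau_linear rGf t.
have KE (c : C) : Kmtau rG m t (c *: k) = (m%:R + c * l k = 0).
  by rewrite /Kmtau /= -lE linearZ.
rewrite !KE; move: (l k) => x E E'; have x0 : x != 0.
  apply: contraTneq m0 => x0; move/eqP: E.
  by rewrite x0 mulr0 addr0 pnatr_eq0 -leqn0 -leqNgt.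
by apply: (mulIf x0); apply: (addrI m%:R); rewrite E E'.
Qed.

Lemma fixed_space_refl_hyperplane g : g \in G -> is_reflection rG g ->
  fixed_space rG g \in refl_hyperplanes rG.
Proof.
move=> gG gr; rewrite mem_refl_hyperplanes// [is_hyperplane _]gr /=.
apply/eqP => st1; have : g \in pstab rG (fixed_space rG g) by rewrite inE gG subvv.
rewrite st1 inE => /eqP g1; move: gr.
rewrite /is_reflection g1 /is_hyperplane.
have -> : fixed_space rG 1%g = fullv.
  by apply/vspaceP => v; rewrite mem_fixed_space repr_mx1 mul1mx eqxx memvf.
by rewrite dimvf /dim /= muln1 -[X in _ == X]addn0 -addn1 eqn_add2l.
Qed.

End Corollary.

Theorem corollary2p21 (R : realType) (n : nat) (gT : finGroupType)
    (G : {group gT}) (rG : mx_representation R[i] G n)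
    (alpha : hyp rG -> 'rV[R[i]]_n) :
  is_complex_reflection_group rG ->
  is_root_choice alpha ->
  exists S : set (nat * Ghat R G),
    [/\ forall m t, S (m, t) ->
          [/\ (0 < m)%N, t != principal_comp (Ghat R G)
            & exists2 p, isotypic rG m (irr_repr t) p & p != 0],
        forall m t, S (m, t) -> affine_hyperplane (Kmtau rG m t),
        Ksing alpha = (\bigcup_(x in S) Kmtau rG x.1 x.2)%classic
      & G :!=: 1%g ->
        infinite_set [set Kmtau rG x.1 x.2 | x in S]%classic].
Proof.
move=> [rGf _ gen] alphaP.
(* Besides inclusion in the singular set, a point of each hyperplane is demanded: it rules out the
   trivial representation and makes the equation a genuine hyperplane. *)
pose S : set (nat * Ghat R G) := [set x | [/\ (0 < x.1)%N, isotypic_neq0 rG x.1 x.2,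
  exists k, Kmtau rG x.1 x.2 k & (Kmtau rG x.1 x.2 `<=` Ksing alpha)%classic]]%classic.
have KS : Ksing alpha = (\bigcup_(x in S) Kmtau rG x.1 x.2)%classic.
  apply/seteqP; split=> [k /(Ksing_cover rGf alphaP)[m [t [m0 mt kK KK]]]|k [x [_ _ _ KK] kK]].
    by exists (m, t) => //; split=> //; exists k.
  exact: KK.
exists S; split=> //.
- move=> m t [/= m0 mt [k kK] _]; split=> //; apply/eqP => tP.
  move/eqP: kK; rewrite /Kmtau /= tP (ctau_principal rGf alphaP) addr0.
  by rewrite pnatr_eq0 -leqn0 leqNgt m0.
- by move=> m t [/= m0 _ [k kK] _]; apply: Kmtau_hyperplane kK.
move=> G1; have [g /andP[gG gr]] : exists g, (g \in G) && is_reflection rG g.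
  apply/existsP; apply: contraNT G1; rewrite negb_exists => /forallP gn.
  rewrite -gen; apply/eqP; rewrite -[RHS]gen0; congr <<_>>%g.
  by apply/setP => g; rewrite !inE (negPf (gn g)).
pose H0 : hyp rG := Sub (fixed_space rG g) (fixed_space_refl_hyperplane rGf gG gr).
have ex_x M : exists x, S x /\
    Kmtau rG x.1 x.2 ((- ((#|G| * M).+1%:R / (eH H0)%:R)) *: first_param H0).
  by have := singular_line rGf alphaP H0 M; rewrite KS => -[x Sx xM]; exists x.
have [x xE] := boolp.choice ex_x.
(* Equal hyperplanes for [M] and [M'] would meet the line through 0 and [first_param H0] in both
   parameters, which therefore coincide. *)
have inj : injective (fun M => Kmtau rG (x M).1 (x M).2).
  move=> M M' MM; have [[m0 _ _ _] xM] := xE M; have [_ xM'] := xE M'.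
  have e0 : (eH H0)%:R != 0 :> R[i] by rewrite pnatr_eq0 -lt0n ltnW// eH_gt1.
  rewrite /= in MM; rewrite -MM in xM'.
  move/oppr_inj/(mulIf (invr_neq0 e0))/eqP: (Kmtau_line_inj rGf m0 xM xM').
  by rewrite eqr_nat eqSS eqn_mul2l -leqn0 leqNgt cardG_gt0 => /eqP.
apply: sub_infinite_set (_ : infinite_set (range (fun M => Kmtau rG (x M).1 (x M).2))).
  by move=> _ [M _ <-]; exists (x M) => //; have [] := xE M.
rewrite (eq_finite_set (inj_card_eq (in2W inj))).
exact: infinite_nat.
Qed.
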